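(* Let $n\in\mathbb{Z}_{\geqslant0}$ and let $k$ be a $\delta$-$\sigma^\ast$-field of characteristic zero. Then, for every $F\subset k[\mathbf{y}_\infty]$ and $f\in k[\mathbf{y}_\infty]$ with $\mathbf{y}=y_1,\ldots,y_n$, the following statements are equivalent: (1) for every $\delta$-$\sigma$-field extension $k\subset K$, $f$ vanishes on all solutions of $F=0$ in $K^{\mathbb{Z}}$; (2) there exists $m\in\mathbb{N}$ such that $\sigma^m(f^m)\in\langle\sigma^j(F)\mid j\in\mathbb{Z}_{\geqslant0}\rangle^{(\infty)}\subset k[\mathbf{y}_\infty]$. Moreover, if $\sigma=\operatorname{id}_k$ on $k$, then (2) is equivalent to: for every $\delta$-$\sigma$-field extension $k\subset K$ with $\sigma=\operatorname{id}_K$ on $K$, $f$ vanishes on all the sequence solutions of $F$ in $K^{\mathbb{Z}}$.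
   Context: A $\delta$-$\sigma$-ring is a commutative ring with a derivation $\delta$ and a ring endomorphism $\sigma$ such that $\delta\sigma=\sigma\delta$; it is a $\delta$-$\sigma$-field if it is a field, and a $\delta$-$\sigma^\ast$-ring (field) if moreover $\sigma$ is an automorphism. Homomorphisms and extensions are compatible with $\delta$ and $\sigma$. $k[\mathbf{y}_\infty]$ is the polynomial ring over $k$ in the algebraically independent variables $\delta^i\sigma^jy_l$ ($i,j\geqslant0$, $1\leqslant l\leqslant n$), with $\delta,\sigma$ extended from $k$ by $\sigma(\delta^i\sigma^jy_l)=\delta^i\sigma^{j+1}y_l$, $\delta(\delta^i\sigma^jy_l)=\delta^{i+1}\sigma^jy_l$. For a subset $G$, $\langle G\rangle^{(\infty)}$ is the differential ideal generated by $G$, i.e. the ideal generated by all $\delta^i(g)$, $i\geqslant0$, $g\in G$. For a $\delta$-$\sigma$-field extension $K\supset k$, the sequence ring $K^{\mathbb{Z}}$ is a $\delta$-$\sigma^\ast$-ring with componentwise ring operations, $\sigma((x_i)_{i\in\mathbb{Z}})=(x_{i+1})_{i\in\mathbb{Z}}$, $\delta((x_i)_{i\in\mathbb{Z}})=(\delta(x_i))_{i\in\mathbb{Z}}$, and it is a $k$-algebra via $a\mapsto(\sigma^i(a))_{i\in\mathbb{Z}}$, $a\in k$. For $\mathbf{a}\in(K^{\mathbb{Z}})^n$ let $\phi_{\mathbf{a}}:k[\mathbf{y}_\infty]\to K^{\mathbb{Z}}$ be the unique $\delta$-$\sigma$-homomorphism over $k$ with $y_l\mapsto a_l$; $f$ vanishes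 at $\mathbf{a}$ (and $\mathbf{a}$ is a solution of $f=0$) if $\phi_{\mathbf{a}}(f)=0$, and $\mathbf{a}$ is a solution of $F=0$ if $\phi_{\mathbf{a}}(g)=0$ for all $g\in F$. Sequence solutions of $F$ in $K^{\mathbb{Z}}$ are such tuples $\mathbf{a}$. *)

(* Defs.v *)
From HB Require Import structures.
From mathcomp Require Import all_boot all_order all_algebra finmap.
From mathcomp Require Import boolp classical_sets functions.
From mathcomp Require Import monalg ring.

Set Implicit Arguments.
Unset Strict Implicit.
Unset Printing Implicit Defensive.

Import GRing.Theory.
Local Open Scope classical_set_scope.
Local Open Scope ring_scope.

HB.mixin Record isDSRing R of GRing.ComPzRing R := {
  delta : R -> R;
  sigma : R -> R;
  deltaD_subproof : {morph delta : x y / x + y};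
  deltaM_subproof : forall x y, delta (x * y) = delta x * y + x * delta y;
  sigmaD_subproof : {morph sigma : x y / x + y};
  sigmaM_subproof : {morph sigma : x y / x * y};
  sigma1_subproof : sigma 1 = 1;
  deltaC_subproof : forall x, delta (sigma x) = sigma (delta x)
}.

#[short(type="dsRingType")]
HB.structure Definition DSRing := { R of GRing.ComPzRing R & isDSRing R }.

#[short(type="dsNzRingType")]
HB.structure Definition DSNzRing := { R of GRing.ComNzRing R & isDSRing R }.

#[short(type="dsFieldType")]
HB.structure Definition DSField := { R of GRing.Field R & isDSRing R }.

(* The inverse of sigma is data, but it is determined by sigma. *)
HB.mixin Record isInversive R of DSRing R := {
  sigmaV : R -> R;
  sigmaK : cancel (@sigma R) sigmaV;
  sigmaVK : cancel sigmaV (@sigma R)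
}.

#[short(type="dsiRingType")]
HB.structure Definition DSIRing := { R of DSRing R & isInversive R }.

#[short(type="dsiFieldType")]
HB.structure Definition DSIField := { R of DSField R & isInversive R }.

Section DSRingTheory.
Variable R : dsRingType.

Lemma delta_is_zmod_morphism : zmod_morphism (@delta R).
Proof.
have d0 : delta 0 = 0 :> R.
  by apply: (addrI (delta 0)); rewrite -deltaD_subproof !addr0.
have dN x : delta (- x) = - delta x :> R.
  by apply/eqP; rewrite -addr_eq0 -deltaD_subproof addNr d0.
by move=> x y; rewrite deltaD_subproof dN.
Qed.

Lemma sigma_is_zmod_morphism : zmod_morphism (@sigma R).
Proof.
have d0 : sigma 0 = 0 :> R.
  by apply: (addrI (sigma 0)); rewrite -sigmaD_subproof !addr0.
have dN x : sigma (- x) = - sigma x :> R.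
  by apply/eqP; rewrite -addr_eq0 -sigmaD_subproof addNr d0.
by move=> x y; rewrite sigmaD_subproof dN.
Qed.

Lemma sigma_is_monoid_morphism : monoid_morphism (@sigma R).
Proof. by split; [exact: sigma1_subproof | exact: sigmaM_subproof]. Qed.

HB.instance Definition _ :=
  GRing.isZmodMorphism.Build R R (@delta R) delta_is_zmod_morphism.
HB.instance Definition _ :=
  GRing.isZmodMorphism.Build R R (@sigma R) sigma_is_zmod_morphism.
HB.instance Definition _ :=
  GRing.isMonoidMorphism.Build R R (@sigma R) sigma_is_monoid_morphism.

Lemma deltaM (x y : R) : delta (x * y) = delta x * y + x * delta y.
Proof. exact: deltaM_subproof. Qed.

Lemma delta1 : delta 1 = 0 :> R.
Proof.
by apply: (addrI (delta 1)); rewrite addr0 -{3}[1]mulr1 deltaM mulr1 mul1r.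
Qed.

Lemma delta_sigma (x : R) : delta (sigma x) = sigma (delta x).
Proof. exact: deltaC_subproof. Qed.

End DSRingTheory.

(* sigmaZ i is the i-th power of the automorphism sigma; Negz p is - p.+1. *)
Definition sigmaZ (R : dsiRingType) (i : int) (x : R) : R :=
  match i with
  | Posz p => iter p (@sigma R) x
  | Negz p => iter p.+1 (@sigmaV R) x
  end.

HB.mixin Record isDSMorphism (R S : dsRingType) (f : R -> S) := {
  dsmorph_delta : {morph f : x / delta x};
  dsmorph_sigma : {morph f : x / sigma x}
}.

HB.structure Definition DSMorphism (R S : dsRingType) :=
  { f of @GRing.RMorphism R S f & isDSMorphism R S f }.

Notation "{ 'dsmorphism' R -> S }" := (DSMorphism.type R S)
  (at level 0, R at level 98, S at level 99,
   format "{ 'dsmorphism'  R  ->  S }") : type_scope.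

Definition ideal_gen (R : comPzRingType) (G : set R) : set R :=
  [set x | exists N (c g : 'I_N -> R),
     (forall i, G (g i)) /\ x = \sum_(i < N) c i * g i].

Definition diff_ideal (R : dsRingType) (G : set R) : set R :=
  ideal_gen [set h | exists i, exists2 g, G g & h = iter i (@delta R) g].

Definition sigma_orbit (R : dsRingType) (F : set R) : set R :=
  [set h | exists j, exists2 g, F g & h = iter j (@sigma R) g].

Definition zseq (K : Type) : Type := int -> K.

HB.instance Definition _ (K : comPzRingType) :=
  GRing.ComPzRing.copy (zseq K) (int -> K).

Section ZseqNz.
Variable K : comNzRingType.

Lemma zseq_oner_neq0 : (1 : zseq K) != 0.
Proof.
apply/eqP => /(congr1 (fun s : zseq K => s 0)) /eqP.
by apply/negP; exact: oner_neq0.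
Qed.

HB.instance Definition _ :=
  GRing.PzSemiRing_isNonZero.Build (zseq K) zseq_oner_neq0.

End ZseqNz.

Section ZseqDS.
Variable K : dsRingType.

Definition zseq_delta (s : zseq K) : zseq K := fun i => delta (s i).
Definition zseq_sigma (s : zseq K) : zseq K := fun i => s (i + 1).
Definition zseq_sigmaV (s : zseq K) : zseq K := fun i => s (i - 1).

Lemma zseq_deltaD : {morph zseq_delta : x y / x + y}.
Proof. by move=> x y; apply/funext => i; exact: raddfD. Qed.

Lemma zseq_deltaM (x y : zseq K) :
  zseq_delta (x * y) = zseq_delta x * y + x * zseq_delta y.
Proof. by apply/funext => i; exact: deltaM. Qed.

Lemma zseq_deltaC (x : zseq K) :
  zseq_delta (zseq_sigma x) = zseq_sigma (zseq_delta x).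
Proof. by []. Qed.

HB.instance Definition _ := isDSRing.Build (zseq K) zseq_deltaD zseq_deltaM
  (fun x y : zseq K => erefl (zseq_sigma (x + y)))
  (fun x y : zseq K => erefl (zseq_sigma (x * y)))
  (erefl (zseq_sigma 1)) zseq_deltaC.

Lemma zseq_sigmaK : cancel (@sigma (zseq K)) zseq_sigmaV.
Proof.
by move=> x; apply/funext => i; rewrite /zseq_sigmaV /sigma /= /zseq_sigma subrK.
Qed.

Lemma zseq_sigmaVK : cancel zseq_sigmaV (@sigma (zseq K)).
Proof.
by move=> x; apply/funext => i; rewrite /zseq_sigmaV /sigma /= /zseq_sigma addrK.
Qed.

HB.instance Definition _ :=
  isInversive.Build (zseq K) zseq_sigmaK zseq_sigmaVK.

End ZseqDS.

HB.instance Definition _ (K : dsNzRingType) := DSRing.on (zseq K).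

(* The index (i, j, l) stands for the variable delta^i sigma^j y_l. *)
Definition dsvar (n : nat) : Type := (nat * nat * 'I_n)%type.
HB.instance Definition _ n := Choice.copy (dsvar n) (nat * nat * 'I_n)%type.

Definition vdelta n (v : dsvar n) : dsvar n := (v.1.1.+1, v.1.2, v.2).
Definition vsigma n (v : dsvar n) : dsvar n := (v.1.1, v.1.2.+1, v.2).

Section CmonomEval.
Variables (I : choiceType) (S : comNzRingType) (x : I -> S).

Definition cmeval (m : {cmonom I}) : S := \prod_(v <- finsupp m) x v ^+ m v.

Lemma cmevalEw (D : {fset I}) (m : {cmonom I}) : (finsupp m `<=` D)%fset ->
  cmeval m = \prod_(v <- D) x v ^+ m v.
Proof.
move=> le; rewrite /cmeval (big_fset_incl _ le) //= => v _.
by rewrite -cmE_eq0 => /eqP ->; rewrite expr0.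
Qed.

Lemma cmeval_is_mmorphism : mmorphism cmeval.
Proof.
split=> [m1 m2|]; last by rewrite /cmeval mdom1 big_seq_fset0.
rewrite (cmevalEw (fsubset_refl _)) mdomD.
rewrite (cmevalEw (fsubsetUl (finsupp m1) (finsupp m2))).
rewrite (cmevalEw (fsubsetUr (finsupp m1) (finsupp m2))).
by rewrite -big_split /=; apply: eq_bigr => v _; rewrite cmM exprD.
Qed.

HB.instance Definition _ := isMultiplicative.Build {cmonom I} S cmeval
  cmeval_is_mmorphism.

Lemma cmevalU v : cmeval (ucm v) = x v.
Proof. by rewrite /cmeval mdomU big_seq_fset1 cmUU expr1. Qed.

End CmonomEval.

Definition dspoly (k : dsNzRingType) (n : nat) : Type :=
  {malg k[{cmonom dsvar n}]}.

HB.instance Definition _ (k : dsNzRingType) n :=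
  GRing.ComAlgebra.copy (dspoly k n) {malg k[{cmonom dsvar n}]}.

Section DSPoly.
Variables (k : dsNzRingType) (n : nat).
Implicit Types (v : dsvar n) (m : {cmonom dsvar n}) (c : k) (f g : dspoly k n).

Definition dspolyC (c : k) : dspoly k n := malgC c.
Definition dspolyX (v : dsvar n) : dspoly k n := << ucm v >>.

HB.instance Definition _ := GRing.RMorphism.copy dspolyC
  (@mkmalgU {cmonom dsvar n} k mone).

Lemma dspolyU c m : << c *g m >> = dspolyC c * << m >> :> dspoly k n.
Proof. by rewrite malgM_def fgmulUU mulr1 mul1m. Qed.

Lemma dspolyUM m1 m2 : (<< mmul m1 m2 >> : dspoly k n) = << m1 >> * << m2 >>.
Proof. by rewrite malgM_def fgmulUU mulr1. Qed.

Lemma dspolyXE m : (<< m >> : dspoly k n) = cmeval dspolyX m.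
Proof.
elim: {m}(mdeg m) {-2}m (leqnn (mdeg m)) => [|d IHd] m.
  by rewrite leqn0 mdeg_eq0 => /eqP ->; rewrite mmorph1.
case: (boolP (finsupp m == fset0)) => [/eqP m0 _|].
  suff -> : m = mone by rewrite mmorph1.
  by apply/eqP/cmP => v; rewrite cm1; apply/eqP; rewrite cmE_eq0 m0.
case/fset0Pn => v vm; have -> : m = mmul (ucm v) (divcm m (ucm v)).
  apply/eqP/cmP => w; rewrite cmM divcmE cmU subnKC //.
  by case: eqP => // <-; rewrite lt0n cmE_neq0.
by rewrite mdegM mdegU ltnS dspolyUM mmorphM /= cmevalU => /IHd ->.
Qed.

Lemma dspoly_ind (P : dspoly k n -> Prop) :
  (forall c, P (dspolyC c)) -> (forall v, P (dspolyX v)) ->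
  (forall f g, P f -> P g -> P (f + g)) ->
  (forall f g, P f -> P g -> P (f * g)) -> forall f, P f.
Proof.
move=> PC PX PD PM f; rewrite [f](@monalgE {cmonom dsvar n} k).
apply: (big_ind P) => [||m _]; last 1 first.
- rewrite (dspolyU (mcoeff m f) m).
  apply: (PM); first exact: PC.
  rewrite (dspolyXE m) /cmeval.
  apply: (big_ind P) => [||v _]; [|exact: PM|].
    by rewrite -(rmorph1 dspolyC); exact: PC.
  elim: (m v) => [|d IHd]; first by rewrite expr0 -(rmorph1 dspolyC); exact: PC.
  by rewrite exprS; apply: (PM); first exact: PX.
- by rewrite -(rmorph0 dspolyC); exact: PC.
- exact: PD.
Qed.

(* sigma acts on coefficients and shifts the variables. *)
Definition dspoly_sigma : dspoly k n -> dspoly k n :=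
  mmap (dspolyC \o @sigma k) (cmeval (dspolyX \o @vsigma n)).

HB.instance Definition _ := GRing.RMorphism.copy dspoly_sigma
  (mmap (dspolyC \o @sigma k) (cmeval (dspolyX \o @vsigma n))).

Lemma dspoly_sigmaC c : dspoly_sigma (dspolyC c) = dspolyC (sigma c).
Proof. exact: mmapC. Qed.

Lemma dspoly_sigmaX v : dspoly_sigma (dspolyX v) = dspolyX (vsigma v).
Proof. by rewrite /dspoly_sigma mmapU /= cmevalU rmorph1 mul1r. Qed.

(* The Leibniz rule on the monomial m:
   sum over v of m(v) * m / v * delta(v). *)
Definition dsmonom_delta (m : {cmonom dsvar n}) : dspoly k n :=
  \sum_(v <- finsupp m) (<< divcm m (ucm v) >> * dspolyX (vdelta v)) *+ m v.

Definition dspoly_delta (f : dspoly k n) : dspoly k n :=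
  \sum_(m <- msupp f)
     (<< delta (mcoeff m f) *g m >> + mcoeff m f *: dsmonom_delta m).

Lemma dsmonom_deltaEw (D : {fset dsvar n}) m : (finsupp m `<=` D)%fset ->
  dsmonom_delta m =
  \sum_(v <- D) (<< divcm m (ucm v) >> * dspolyX (vdelta v)) *+ m v.
Proof.
move=> le; rewrite /dsmonom_delta (big_fset_incl _ le) //= => v _.
by rewrite -cmE_eq0 => /eqP ->; rewrite mulr0n.
Qed.

Let leibniz_aux (S : comNzRingType) (X Y A1 A2 M1 M2 : S) (a b : nat) :
    ((0 < a)%N -> X = A1 * M2) -> ((0 < b)%N -> X = M1 * A2) ->
  (X * Y) *+ (a + b) = (A1 * Y) *+ a * M2 + M1 * ((A2 * Y) *+ b).
Proof.
move=> hA hB; rewrite mulrnDr mulrnAl mulrnAr; congr (_ + _).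
  by case: (posnP a) => [->|/hA ->]; rewrite ?mulr0n // mulrAC.
by case: (posnP b) => [->|/hB ->]; rewrite ?mulr0n // mulrA.
Qed.

Lemma dsmonom_deltaM m1 m2 :
  dsmonom_delta (mmul m1 m2) =
  dsmonom_delta m1 * << m2 >> + << m1 >> * dsmonom_delta m2.
Proof.
rewrite (dsmonom_deltaEw (fsubset_refl _)) mdomD.
rewrite (dsmonom_deltaEw (fsubsetUl (finsupp m1) (finsupp m2))).
rewrite (dsmonom_deltaEw (fsubsetUr (finsupp m1) (finsupp m2))).
move: (finsupp m1 `|` finsupp m2)%fset => D.
rewrite [X in _ = X + _]mulr_suml [X in _ = _ + X]mulr_sumr -big_split /=.
apply: eq_bigr => v _.
rewrite cmM; apply: leibniz_aux => mv_gt0; rewrite -dspolyUM; congr << _ >>.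
  apply/eqP/cmP => w; rewrite !(cmM, divcmE) cmU addnBAC //.
  by case: eqP => // <-.
apply/eqP/cmP => w; rewrite !(cmM, divcmE) cmU addnBA //.
by case: eqP => // <-.
Qed.

Lemma dspoly_deltaE f :
  dspoly_delta f = mmap (dspolyC \o @delta k) (fun m => << m >> : dspoly k n) f
                   + mmap dspolyC dsmonom_delta f.
Proof.
rewrite /dspoly_delta /mmap -big_split; apply: eq_bigr => m _ /=.
by rewrite dspolyU -mul_malgC.
Qed.

Lemma dspoly_deltaD : {morph dspoly_delta : f g / f + g}.
Proof. move=> f g; rewrite !dspoly_deltaE [X in X + _ = _]mmapD [X in _ + X = _]mmapD.
exact: addrACA. Qed.

Lemma dspoly_deltaU c m :
  dspoly_delta << c *g m >> =
  dspolyC (delta c) * << m >> + dspolyC c * dsmonom_delta m.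
Proof. by rewrite dspoly_deltaE [X in X + _ = _]mmapU [X in _ + X = _]mmapU. Qed.

Lemma dspoly_delta0 : dspoly_delta 0 = 0.
Proof. by rewrite dspoly_deltaE [X in X + _ = _]mmap0 [X in _ + X = _]mmap0 addr0. Qed.

Let leibniz_mono_aux (S : comNzRingType) (a b da db X Y dX dY : S) :
  (da * b + a * db) * (X * Y) + a * b * (dX * Y + X * dY) =
  (da * X + a * dX) * (b * Y) + a * X * (db * Y + b * dY).
Proof.
ring.
Qed.

Lemma dspoly_deltaMU c1 c2 m1 m2 :
  dspoly_delta (<< c1 *g m1 >> * << c2 *g m2 >> : dspoly k n) =
  dspoly_delta << c1 *g m1 >> * << c2 *g m2 >> +
  << c1 *g m1 >> * dspoly_delta << c2 *g m2 >>.
Proof.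
have -> : << c1 *g m1 >> * << c2 *g m2 >> = << c1 * c2 *g mmul m1 m2 >>
          :> dspoly k n by rewrite malgM_def fgmulUU.
rewrite [X in X = _](dspoly_deltaU _ (mmul m1 m2)).
rewrite [X in _ = X * _ + _](dspoly_deltaU c1 m1).
rewrite [X in _ = _ + _ * X](dspoly_deltaU c2 m2).
rewrite (dsmonom_deltaM m1 m2).
rewrite [X in dspolyC _ * X + _ = _](dspolyUM m1 m2).
rewrite (deltaM c1 c2).
rewrite [X in _ = _ * _ + X * _](dspolyU c1 m1).
rewrite [X in _ = _ * X + _](dspolyU c2 m2).
rewrite (rmorphD dspolyC).
rewrite (rmorphM dspolyC _ c2).
rewrite (rmorphM dspolyC c1 (delta c2)).
rewrite [X in _ + X * _ = _](rmorphM dspolyC c1 c2).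
exact: leibniz_mono_aux.
Qed.

Lemma dspoly_deltaM f g :
  dspoly_delta (f * g) = dspoly_delta f * g + f * dspoly_delta g.
Proof.
have dsum := big_morph dspoly_delta dspoly_deltaD dspoly_delta0.
rewrite [f](@monalgE {cmonom dsvar n} k) [g](@monalgE {cmonom dsvar n} k).
move: (msupp f) (msupp g) => F G.
rewrite [X in dspoly_delta X]mulr_suml.
rewrite [X in X = _]dsum.
rewrite [X in _ = X * _ + _]dsum.
rewrite [X in _ = X + _]mulr_suml [X in _ = _ + X]mulr_suml -big_split.
apply: eq_bigr => m1 _ /=.
rewrite [X in dspoly_delta X]mulr_sumr [X in X = _]dsum.
rewrite [X in _ = _ + _ * X]dsum.
rewrite [X in _ = X + _]mulr_sumr [X in _ = _ + X]mulr_sumr -big_split.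
apply: eq_bigr => m2 _ /=; move: (mcoeff _ _) (mcoeff _ _) => a b.
exact: dspoly_deltaMU.
Qed.

Lemma dspoly_deltaC c : dspoly_delta (dspolyC c) = dspolyC (delta c).
Proof.
have dm1 : dsmonom_delta mone = 0 by rewrite /dsmonom_delta mdom1 big_seq_fset0.
rewrite [LHS](dspoly_deltaU c mone) dm1 [X in _ + X = _]mulr0 [LHS]addr0.
exact: mulr1.
Qed.

Lemma dspoly_deltaX v : dspoly_delta (dspolyX v) = dspolyX (vdelta v).
Proof.
have vv1 : divcm (ucm v) (ucm v) = mone.
  by apply/eqP/cmP => w; rewrite divcmE subnn cm1.
have dmv : dsmonom_delta (ucm v) = dspolyX (vdelta v).
  by rewrite /dsmonom_delta mdomU big_seq_fset1 cmUU vv1; exact: mul1r.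
rewrite [LHS](dspoly_deltaU 1 (ucm v)) delta1 (rmorph0 dspolyC) dmv.
by rewrite [X in X + _ = _]mul0r [LHS]add0r (rmorph1 dspolyC) [LHS]mul1r.
Qed.

Lemma dspoly_delta_sigma f :
  dspoly_delta (dspoly_sigma f) = dspoly_sigma (dspoly_delta f).
Proof.
elim/dspoly_ind: f => [c|v|f g IHf IHg|f g IHf IHg].
- rewrite [X in dspoly_delta X = _](dspoly_sigmaC c).
  rewrite [X in _ = dspoly_sigma X](dspoly_deltaC c).
  by rewrite [LHS]dspoly_deltaC [RHS]dspoly_sigmaC delta_sigma.
- rewrite [X in dspoly_delta X = _](dspoly_sigmaX v).
  rewrite [X in _ = dspoly_sigma X](dspoly_deltaX v).
  by rewrite [LHS]dspoly_deltaX [RHS]dspoly_sigmaX.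
- rewrite [X in dspoly_delta X = _](rmorphD dspoly_sigma f g).
  rewrite [X in _ = dspoly_sigma X](dspoly_deltaD f g).
  rewrite [LHS]dspoly_deltaD [RHS](rmorphD dspoly_sigma).
  by rewrite [X in X + _ = _]IHf [X in _ + X = _]IHg.
- rewrite [X in dspoly_delta X = _](rmorphM dspoly_sigma f g).
  rewrite [X in _ = dspoly_sigma X](dspoly_deltaM f g).
  rewrite [LHS]dspoly_deltaM [RHS](rmorphD dspoly_sigma).
  rewrite [X in X * _ + _ = _]IHf [X in _ + _ * X = _]IHg.
  rewrite [X in _ = X + _](rmorphM dspoly_sigma).
  by rewrite [X in _ = _ + X](rmorphM dspoly_sigma).
Qed.

HB.instance Definition _ := isDSRing.Build (dspoly k n)
  dspoly_deltaD dspoly_deltaM (rmorphD dspoly_sigma) (rmorphM dspoly_sigma)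
  (rmorph1 dspoly_sigma) dspoly_delta_sigma.

End DSPoly.

Section SigmaZ.
Variable R : dsiRingType.
Implicit Types x y : R.

Lemma sigma_inj : injective (@sigma R).
Proof. exact: can_inj sigmaK. Qed.

Lemma sigmaVD : {morph @sigmaV R : x y / x + y}.
Proof. by move=> x y; apply: sigma_inj; rewrite rmorphD /= !sigmaVK. Qed.

Lemma sigmaVM : {morph @sigmaV R : x y / x * y}.
Proof. by move=> x y; apply: sigma_inj; rewrite rmorphM /= !sigmaVK. Qed.

Lemma sigmaV1 : sigmaV 1 = 1 :> R.
Proof. by apply: sigma_inj; rewrite sigmaVK rmorph1. Qed.

Lemma delta_sigmaV x : delta (sigmaV x) = sigmaV (delta x).
Proof. by apply: sigma_inj; rewrite -delta_sigma !sigmaVK. Qed.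

Lemma sigmaZD i : {morph @sigmaZ R i : x y / x + y}.
Proof.
move=> x y; case: i => p /=.
  by elim: p => //= p ->; rewrite rmorphD.
by elim: p => [|p IHp] /=; rewrite ?IHp sigmaVD.
Qed.

Lemma sigmaZM i : {morph @sigmaZ R i : x y / x * y}.
Proof.
move=> x y; case: i => p /=.
  by elim: p => //= p ->; rewrite rmorphM.
by elim: p => [|p IHp] /=; rewrite ?IHp sigmaVM.
Qed.

Lemma sigmaZ1 i : sigmaZ i 1 = 1 :> R.
Proof.
case: i => p /=; first by elim: p => //= p ->; rewrite rmorph1.
by elim: p => [|p IHp] /=; rewrite ?IHp sigmaV1.
Qed.

Lemma delta_sigmaZ i x : delta (sigmaZ i x) = sigmaZ i (delta x).
Proof.
case: i => p /=; first by elim: p => //= p IHp; rewrite delta_sigma IHp.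
by elim: p => [|p IHp] /=; rewrite delta_sigmaV ?IHp.
Qed.

Lemma sigmaZS i x : sigmaZ (i + 1) x = sigmaZ i (sigma x).
Proof.
case: i => [p|[|p]]; first by rewrite addrC -intS /= -iterSr.
  by rewrite (_ : Negz 0 + 1 = Posz 0) //= sigmaK.
rewrite (_ : Negz p.+1 + 1 = Negz p).
  by rewrite /sigmaZ [in RHS]iterSr sigmaK.
by rewrite !NegzE (intS p.+1) opprD addrAC addNr add0r.
Qed.

End SigmaZ.

Section Solutions.
Variables (k : dsiFieldType) (K : dsFieldType) (iota : {dsmorphism k -> K}).

Definition zseqC (c : k) : zseq K := fun i => iota (sigmaZ i c).

Lemma zseqC_is_zmod_morphism : zmod_morphism zseqC.
Proof.
have zD : {morph zseqC : x y / x + y}.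
  by move=> x y; apply/funext => i; rewrite /zseqC sigmaZD rmorphD.
move=> x y; apply/(canRL (addrK (zseqC y))).
by rewrite -zD subrK.
Qed.

Lemma zseqC_is_monoid_morphism : monoid_morphism zseqC.
Proof.
split=> [|x y]; apply/funext => i.
  by rewrite /zseqC sigmaZ1 rmorph1.
by rewrite /zseqC sigmaZM rmorphM.
Qed.

HB.instance Definition _ :=
  GRing.isZmodMorphism.Build k (zseq K) zseqC zseqC_is_zmod_morphism.
HB.instance Definition _ :=
  GRing.isMonoidMorphism.Build k (zseq K) zseqC zseqC_is_monoid_morphism.

Lemma zseqC_delta : {morph zseqC : x / delta x}.
Proof.
move=> x; apply/funext => i; rewrite /zseqC -delta_sigmaZ.
by rewrite (dsmorph_delta (s := iota)).
Qed.

Lemma zseqC_sigma : {morph zseqC : x / sigma x}.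
Proof. by move=> x; apply/funext => i; rewrite /zseqC -sigmaZS. Qed.

HB.instance Definition _ := isDSMorphism.Build k (zseq K) zseqC
  zseqC_delta zseqC_sigma.

Variables (n : nat) (a : 'I_n -> zseq K).

Definition dsvar_eval (v : dsvar n) : zseq K :=
  iter v.1.1 (@delta (zseq K)) (iter v.1.2 (@sigma (zseq K)) (a v.2)).

(* phi_a, the unique delta-sigma-homomorphism over k sending y_l to a_l:
   see dspoly_evalC, dspoly_evalX and dspoly_evalP. *)
Definition dspoly_eval : dspoly k n -> zseq K :=
  mmap zseqC (cmeval dsvar_eval).

HB.instance Definition _ := GRing.RMorphism.copy dspoly_eval
  (mmap zseqC (cmeval dsvar_eval)).

Lemma dspoly_evalC c : dspoly_eval (dspolyC n c) = zseqC c.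
Proof. exact: mmapC. Qed.

Lemma dspoly_evalX v : dspoly_eval (dspolyX k v) = dsvar_eval v.
Proof. by rewrite /dspoly_eval mmapU cmevalU /= (rmorph1 zseqC) mul1r. Qed.

Definition dspolyY (l : 'I_n) : dspoly k n := dspolyX k (0%N, 0%N, l).

Lemma dsvar_eval_delta v : dsvar_eval (vdelta v) = delta (dsvar_eval v).
Proof. by []. Qed.

Lemma dsvar_eval_sigma v : dsvar_eval (vsigma v) = sigma (dsvar_eval v).
Proof.
case: v => [[i j] l]; rewrite /dsvar_eval /=.
by elim: i => //= i ->; rewrite delta_sigma.
Qed.

Lemma dspoly_eval_delta : {morph dspoly_eval : f / delta f}.
Proof.
elim/dspoly_ind => [c|v|f g IHf IHg|f g IHf IHg].
- rewrite [X in dspoly_eval X = _](dspoly_deltaC n c).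
  by rewrite [LHS]dspoly_evalC [X in _ = delta X]dspoly_evalC zseqC_delta.
- rewrite [X in dspoly_eval X = _](dspoly_deltaX k v).
  by rewrite [LHS]dspoly_evalX [X in _ = delta X]dspoly_evalX.
- rewrite [X in dspoly_eval X = _](dspoly_deltaD f g).
  rewrite [LHS](rmorphD dspoly_eval) [X in _ = delta X](rmorphD dspoly_eval).
  by rewrite [X in X + _ = _]IHf [X in _ + X = _]IHg raddfD.
- rewrite [X in dspoly_eval X = _](dspoly_deltaM f g).
  rewrite [LHS](rmorphD dspoly_eval) [X in _ = delta X](rmorphM dspoly_eval).
  rewrite [X in X + _ = _](rmorphM dspoly_eval).
  rewrite [X in _ + X = _](rmorphM dspoly_eval).
  by rewrite [X in X * _ + _ = _]IHf [X in _ + _ * X = _]IHg deltaM.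
Qed.

Lemma dspoly_eval_sigma : {morph dspoly_eval : f / sigma f}.
Proof.
elim/dspoly_ind => [c|v|f g IHf IHg|f g IHf IHg].
- rewrite [X in dspoly_eval X = _](dspoly_sigmaC n c).
  by rewrite [LHS]dspoly_evalC [X in _ = sigma X]dspoly_evalC zseqC_sigma.
- rewrite [X in dspoly_eval X = _](dspoly_sigmaX k v).
  by rewrite [LHS]dspoly_evalX [X in _ = sigma X]dspoly_evalX dsvar_eval_sigma.
- rewrite [X in dspoly_eval X = _](rmorphD (@sigma (dspoly k n)) f g).
  rewrite [LHS](rmorphD dspoly_eval) [X in _ = sigma X](rmorphD dspoly_eval).
  by rewrite [X in X + _ = _]IHf [X in _ + X = _]IHg rmorphD.
- rewrite [X in dspoly_eval X = _](rmorphM (@sigma (dspoly k n)) f g).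
  rewrite [LHS](rmorphM dspoly_eval) [X in _ = sigma X](rmorphM dspoly_eval).
  by rewrite [X in X * _ = _]IHf [X in _ * X = _]IHg rmorphM.
Qed.

HB.instance Definition _ := isDSMorphism.Build (dspoly k n) (zseq K) dspoly_eval
  dspoly_eval_delta dspoly_eval_sigma.

Lemma dspolyX_iter (v : dsvar n) :
  dspolyX k v =
  iter v.1.1 (@delta (dspoly k n))
    (iter v.1.2 (@sigma (dspoly k n)) (dspolyY v.2)).
Proof.
case: v => [[i j] l] /=; elim: i => [|i IHi] /=; last first.
  rewrite [X in _ = delta X](esym IHi).
  exact: (esym (dspoly_deltaX k (i, j, l))).
elim: j => [|j IHj] /=; first by [].
rewrite [X in _ = sigma X](esym IHj).
exact: (esym (dspoly_sigmaX k (0%N, j, l))).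
Qed.

Lemma dspoly_evalP (phi : {dsmorphism dspoly k n -> zseq K}) :
  (forall c, phi (dspolyC n c) = zseqC c) ->
  (forall l, phi (dspolyY l) = a l) -> phi =1 dspoly_eval.
Proof.
move=> phiC phiY; elim/dspoly_ind => [c|v|f g IHf IHg|f g IHf IHg].
- by rewrite [LHS]phiC [RHS]dspoly_evalC.
- rewrite [RHS]dspoly_evalX [X in phi X = _]dspolyX_iter /dsvar_eval -phiY.
  elim: v.1.1 => /= [|i IHi]; last by rewrite [LHS](dsmorph_delta (s := phi)) IHi.
  by elim: v.1.2 => //= j IHj; rewrite [LHS](dsmorph_sigma (s := phi)) IHj.
- rewrite [LHS](rmorphD phi) [RHS](rmorphD dspoly_eval).
  exact: (f_equal2 +%R IHf IHg).
- rewrite [LHS](rmorphM phi) [RHS](rmorphM dspoly_eval).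
  exact: (f_equal2 *%R IHf IHg).
Qed.

Definition vanishes_at (f : dspoly k n) : Prop := dspoly_eval f = 0.

Definition is_solution (F : set (dspoly k n)) : Prop :=
  forall g, F g -> vanishes_at g.

End Solutions.

(* Main.v *)
Require Import Defs.
From HB Require Import structures.
From mathcomp Require Import all_boot all_order all_algebra finmap.
From mathcomp Require Import boolp classical_sets functions.
From mathcomp Require Import monalg ring zify.

Set Implicit Arguments.
Unset Strict Implicit.
Unset Printing Implicit Defensive.

Import GRing.Theory.
Local Open Scope classical_set_scope.
Local Open Scope ring_scope.

(** Write k{y} for the ring [dspoly k n].  If some sigma^m (f ^ m) lies in the
difference-differential ideal J of F, every delta-sigma-homomorphism to K^Z
that kills F kills it, and f vanishes because K^Z is reduced and sigma is
injective on it.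

For the converse, suppose that no sigma^m (f ^ m) lies in J.  Let R be the
polynomial ring over k in the variables delta^i sigma^j y_l with j allowed to
be any integer.  For each integer r, sigma^r maps k{y} into R, by the maps
[tau r].  No power of f lies in the ideal of R generated by all the
sigma^r delta^e g with g in F: a relation in R, shifted by a large power of
sigma, becomes a relation in k{y} ([descent]).  A prime ideal of R avoiding
the powers of f gives a homomorphism p from R to a field E that kills this
ideal but not f ([exists_field_point]).  Neither delta nor sigma acts on E;
they are recovered separately.

- The derivation comes from Taylor expansion.  For h in k{y}, the sequence of
  the values p (sigma^r delta^i h), i >= 0, is a Hurwitz series, a form of the
  power series sum p (sigma^r delta^i h) t^i / i!, on which d/dt is the shift.
  In characteristic zero these series form a domain, and K is its fraction
  field with derivation d/dt.

- The endomorphism sigma acts on K through the coefficients.  This needs only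
  an endomorphism of the field of coefficients that extends sigma on k, and
  no compatibility with a derivation.  Such an endomorphism exists on an
  extension L of E ([exists_sigma_extension]).  It is the limit of a tower in
  which each step glues two extensions of a field into a common one
  ([exists_amalgam]); that this is possible says that the tensor product of
  two extensions is not zero.

The entry of the solution at r is the Taylor expansion of sigma^r y_l
([exists_sequence_point]).  When sigma is the identity on k, one can take
L = E with the identity, and then sigma is the identity on K. *)

(** * Prime ideals and homomorphisms to fields *)

Section MaximalClosed.
Variables (T J : Type) (op : J -> T -> T -> T).

Definition op_closed (A : set T) : Prop :=
  forall j x y, A x -> A y -> A (op j x y).

(** Zorn's lemma in the form common to its two uses here: prime ideals are
ideals maximal among those avoiding the powers of an element, and linear forms
are read off from subspaces maximal among those avoiding a vector. *)
Lemma exists_maximal_closed (A0 B : set T) (x0 : T) :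
  A0 x0 -> op_closed A0 -> (forall x, B x -> ~ A0 x) ->
  exists A, [/\ A0 `<=` A, op_closed A, (forall x, B x -> ~ A x) &
    forall A', A `<=` A' -> op_closed A' -> (forall x, B x -> ~ A' x) ->
      A' `<=` A].
Proof.
move=> A0x0 clA0 BA0.
pose good A := [/\ A0 `<=` A, op_closed A & forall x, B x -> ~ A x].
(* The empty set is added because [Zorn_bigcup] also asks for the union of
   the empty chain. *)
have [|A [PA maxA]] := @Zorn_bigcup T (fun A => A = set0 \/ good A).
  move=> C CP Ctot; case: (pselect (exists2 X, C X & X !=set0)); last first.
    move=> noX; left; apply/seteqP; split=> // x [X CX Xx].
    by apply: noX; exists X => //; exists x.
  have inC X x : C X -> X x -> good X.
    by move=> CX Xx; have [X0|//] := CP _ CX; rewrite X0 in Xx.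
  move=> [X CX [x Xx]]; right; split.
  - move=> y A0y; exists X => //; have [A0X _ _] := inC _ _ CX Xx.
    exact: A0X.
  - move=> j y z [Y CY Yy] [Z CZ Zz].
    have [YZ|ZY] := Ctot _ _ CY CZ.
      exists Z => //; have [_ clZ _] := inC _ _ CZ Zz.
      by apply: clZ => //; exact: YZ.
    exists Y => //; have [_ clY _] := inC _ _ CY Yy.
    by apply: clY => //; exact: ZY.
  - by move=> y By [Y CY Yy]; have [_ _ /(_ _ By)] := inC _ _ CY Yy.
have {PA}[A0A clA BA] : good A.
  case: PA => // Ae; exfalso; apply: (maxA A0); last by right; split.
  by rewrite Ae; split=> // /(_ x0); exact.
exists A; split=> // A' AA' clA' BA'; apply: contrapT => nA'A.
by apply: (maxA A'); [split | right; split=> //; exact: subset_trans AA'].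
Qed.

End MaximalClosed.

(** The unit ideal is included, so that [ideal_gen G] always qualifies. *)
Definition is_ideal (R : comPzRingType) (A : set R) : Prop :=
  A 0 /\ forall a x y, A x -> A y -> A (a * x + y).

Section Ideals.
Variable R : comPzRingType.
Implicit Types (A G : set R) (x y : R).

Lemma is_ideal_sum A (I : Type) (r : seq I) (F : I -> R) :
  is_ideal A -> (forall i, A (F i)) -> A (\sum_(i <- r) F i).
Proof.
move=> [A0 AD] AF; apply: (big_ind A) => // x y Ax Ay.
by rewrite -[x]mul1r; exact: AD.
Qed.

Lemma is_idealM A a x : is_ideal A -> A x -> A (a * x).
Proof. by move=> [A0 AD] Ax; rewrite -[_ * _]addr0; exact: AD. Qed.

Lemma ideal_gen_is_ideal G : is_ideal (ideal_gen G).
Proof.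
split.
  exists 0%N, (fun=> 0), (fun=> 0); split; first by case.
  by rewrite big_ord0.
move=> a x y [n1 [c1 [g1 [Gg1 ->]]]] [n2 [c2 [g2 [Gg2 ->]]]].
exists (n1 + n2)%N.
exists (fun i : 'I_(n1 + n2) =>
  match fintype.split i with inl j => a * c1 j | inr j => c2 j end).
exists (fun i : 'I_(n1 + n2) =>
  match fintype.split i with inl j => g1 j | inr j => g2 j end).
split=> [i|]; first by case: fintype.split.
rewrite big_split_ord mulr_sumr; congr (_ + _); apply: eq_bigr => i _.
  by rewrite (unsplitK (inl _ i)) mulrA.
by rewrite (unsplitK (inr _ i)).
Qed.

Lemma ideal_gen_mem G x : G x -> ideal_gen G x.
Proof.
move=> Gx; exists 1%N, (fun=> 1), (fun=> x); split=> //.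
by rewrite big_ord1 mul1r.
Qed.

(** The induction principle of generated ideals: all later statements about
[ideal_gen] and [diff_ideal] are obtained by naming a suitable ideal [A]. *)
Lemma ideal_gen_sub G A : is_ideal A -> G `<=` A -> ideal_gen G `<=` A.
Proof.
move=> iA GA _ [n [c [g [Gg ->]]]]; apply: is_ideal_sum => // i.
by apply: is_idealM => //; exact: GA.
Qed.

(** An ideal maximal among those avoiding the powers of [f] is prime: if it
contained neither x nor y, then adding either to it would catch a power of [f],
and the product of the two powers would lie in it together with x * y. *)
Lemma exists_prime_ideal G (f : R) :
  (forall m, ~ ideal_gen G (f ^+ m)) ->
  exists A, [/\ is_ideal A, G `<=` A, ~ A f, ~ A 1 &
    forall x y, A (x * y) -> A x \/ A y].
Proof.
move=> fG; have [G0 GD] := ideal_gen_is_ideal G.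
have [||A [GA AD fA maxA]] := @exists_maximal_closed R R
  (fun a x y => a * x + y) (ideal_gen G) [set y | exists m, y = f ^+ m] 0 G0.
- exact: GD.
- by move=> _ [m ->]; exact: fG.
have iA : is_ideal A by split=> //; exact: GA.
have {}fA m : ~ A (f ^+ m) by apply: fA; exists m.
have extend u : ~ A u -> exists m x a, A x /\ f ^+ m = x + a * u.
  move=> Au; apply: contrapT => no.
  apply: Au; apply: (maxA [set z | exists x a, A x /\ z = x + a * u]).
  - by move=> x Ax; exists x, 0; rewrite mul0r addr0.
  - move=> a x y [x' [b [Ax' ->]]] [y' [c [Ay' ->]]].
    exists (a * x' + y'), (a * b + c); split; first exact: AD.
    by rewrite mulrDr mulrDl mulrA addrACA.
  - by move=> _ [m ->] [x [a [Ax fm]]]; apply: no; exists m, x, a.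
  - by exists 0, 1; rewrite mul1r add0r; split=> //; exact: iA.1.
exists A; split=> //.
- by move=> x Gx; apply/GA/ideal_gen_mem.
- by move=> Af; apply: (fA 1%N); rewrite expr1.
- by rewrite -(expr0 f); exact: fA.
move=> x y Axy; apply: contrapT => /not_orP[Ax Ay].
have [m1 [x1 [a1 [Ax1 E1]]]] := extend _ Ax.
have [m2 [x2 [a2 [Ax2 E2]]]] := extend _ Ay.
apply: (fA (m1 + m2)%N); rewrite exprD E1 E2.
have -> : (x1 + a1 * x) * (x2 + a2 * y) =
  (x2 + a2 * y) * x1 + (a1 * x * x2 + a1 * a2 * (x * y)) by ring.
by apply: iA.2 => //; apply: iA.2 => //; exact: is_idealM.
Qed.

End Ideals.

Section ClassicalUnits.
Variable R : comNzRingType.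

Definition has_inv : {pred R} := fun x => `[< exists y, y * x = 1 >].

Definition pick_inv (x : R) : R :=
  if pselect (exists y, y * x = 1) is left e then projT1 (cid e) else x.

Lemma pick_invP : {in has_inv, left_inverse 1 pick_inv *%R}.
Proof.
move=> x /asboolP ex; rewrite /pick_inv; case: pselect => // e.
exact: projT2 (cid e).
Qed.

Lemma has_invPl (x y : R) : y * x = 1 -> has_inv x.
Proof. by move=> yx; apply/asboolP; exists y. Qed.

Lemma pick_inv_out : {in [predC has_inv], pick_inv =1 id}.
Proof.
move=> x; rewrite inE /= => /asboolPn nex; rewrite /pick_inv.
by case: pselect.
Qed.

End ClassicalUnits.

(** A copy of [R] that carries the classical inverse. *)
Definition cunit (R : comNzRingType) : Type := R.

HB.instance Definition _ (R : comNzRingType) := GRing.ComNzRing.on (cunit R).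
HB.instance Definition _ (R : comNzRingType) :=
  GRing.ComNzRing_hasMulInverse.Build (cunit R)
    (@pick_invP R) (@has_invPl R) (@pick_inv_out R).

Definition domain_of (R : comNzRingType)
  (dom : forall x y : R, x * y = 0 -> (x == 0) || (y == 0)) : Type := cunit R.

HB.instance Definition _ R dom := GRing.ComUnitRing.on (@domain_of R dom).
HB.instance Definition _ R dom :=
  GRing.ComUnitRing_isIntegral.Build (@domain_of R dom) dom.

Definition field_of (R : comNzRingType)
  (inv : forall x : R, x != 0 -> exists y, y * x = 1) : Type := cunit R.

Fact field_of_axiom (R : comNzRingType)
  (inv : forall x : R, x != 0 -> exists y, y * x = 1) :
  GRing.field_axiom (cunit R).
Proof. by move=> x /inv ex; apply/asboolP. Qed.

HB.instance Definition _ R inv := GRing.ComUnitRing.on (@field_of R inv).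
HB.instance Definition _ R inv :=
  GRing.ComUnitRing_isField.Build (@field_of R inv) (field_of_axiom inv).

Section Quotients.
Variables (R : comNzRingType) (A : set R).
Hypotheses (iA : is_ideal A) (A1 : ~ A 1).

Local Open Scope quotient_scope.

Lemma exists_quotient_ring :
  exists (Q : comNzRingType) (p : {rmorphism R -> Q}),
  (forall x, p x = 0 <-> A x) /\ (forall z, exists x, p x = z).
Proof.
have [A0 AD] := iA; pose S : {pred R} := fun x => `[< A x >].
have Sid : idealr_closed S.
  split; [exact/asboolP | exact/asboolPn |].
  move=> a x y /asboolP Ax /asboolP Ay.
  by apply/asboolP; exact: AD.
pose I : idealr R := HB.pack S (isIdealr.Build R S Sid).
pose p : {rmorphism R -> {ideal_quot I}} :=
  GRing.RMorphism.clone _ _ \pi_({ideal_quot I}) _.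
have p0 x : (p x == 0) = (x \in I).
  by rewrite -(rmorph0 p) -[x in RHS]subr0 Quotient.idealrBE.
exists {ideal_quot I}, p; split=> [x|z]; last by exists (repr z); exact: reprK.
split=> [/eqP|Ax]; last apply/eqP; rewrite p0; first by move/asboolP.
exact/asboolP.
Qed.

Lemma exists_residue_field : (forall x, ~ A x -> exists y, A (y * x - 1)) ->
  exists (L : fieldType) (p : {rmorphism R -> L}),
    (forall x, p x = 0 <-> A x) /\ (forall z, exists x, p x = z).
Proof.
move=> Amax; have [Q [p [p0 ps]]] := exists_quotient_ring.
have Qinv (z : Q) : z != 0 -> exists y, y * z = 1.
  have [x <-] := ps z; move=> /eqP px.
  have [y /p0 pyx] := Amax x (fun Ax => px ((p0 x).2 Ax)); exists (p y).
  by apply/eqP; rewrite -subr_eq0 -rmorphM -(rmorph1 p) -rmorphB pyx.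
by exists (field_of Qinv), p.
Qed.

Lemma exists_fraction_field : (forall x y, A (x * y) -> A x \/ A y) ->
  exists (E : fieldType) (p : {rmorphism R -> E}), forall x, p x = 0 <-> A x.
Proof.
move=> Aprime; have [Q [p [p0 ps]]] := exists_quotient_ring.
have Qdom (z w : Q) : z * w = 0 -> (z == 0) || (w == 0).
  have [[x <-] [y <-]] := (ps z, ps w); rewrite -rmorphM => /p0/Aprime.
  by case=> /p0 ->; rewrite eqxx ?orbT.
pose D := domain_of Qdom.
pose pD : {rmorphism R -> D} := p.
pose pF : {rmorphism D -> {fraction D}} :=
  GRing.RMorphism.clone _ _ (@FracField.tofrac D) _.
exists {fraction D}, (GRing.RMorphism.clone _ _ (pF \o pD) _) => x.
rewrite -p0; split=> [/eqP|px]; last by rewrite /= [pD x]px tofrac0.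
by rewrite tofrac_eq0 => /eqP.
Qed.

End Quotients.

(** A Nullstellensatz for arbitrarily many elements: the field may be a large
extension, which is what makes it hold without any finiteness. *)
Lemma exists_field_point (R : comNzRingType) (G : set R) (f : R) :
  (forall m, ~ ideal_gen G (f ^+ m)) ->
  exists (E : fieldType) (p : {rmorphism R -> E}),
    (forall g, G g -> p g = 0) /\ p f != 0.
Proof.
move=> /exists_prime_ideal[A [iA GA Af A1 Aprime]].
have [E [p pA]] := exists_fraction_field iA A1 Aprime.
exists E, p; split=> [g /GA /pA //|]; by apply/eqP => /pA.
Qed.

(** * Amalgamation of field extensions *)

Section LinearRetraction.
Variables (k0 E : fieldType) (u : {rmorphism k0 -> E}).

(** A subspace W maximal among those that do not contain 1 is a hyperplane
supplementary to the line of 1, and [rho] is the projection along W. *)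
Lemma exists_retraction : exists rho : {additive E -> k0},
  (forall a x, rho (u a * x) = a * rho x) /\ rho 1 = 1.
Proof.
pose op a (x y : E) := u a * x + y.
have [|||W [W0 WD W1 maxW]] :=
    @exists_maximal_closed E k0 op [set 0] [set 1] 0.
- by [].
- by move=> a x y -> ->; rewrite /op mulr0 addr0.
- by move=> _ -> /eqP; rewrite oner_eq0.
have {}W1 : ~ W 1 by exact: W1.
have {}W0 : W 0 by exact: W0.
have WZ a x : W x -> W (u a * x).
  by move=> Wx; rewrite -[_ * _]addr0; exact: WD.
have dec x : exists a, W (x - u a).
  apply: contrapT => nx; apply: (nx); exists 0; rewrite rmorph0 subr0.
  apply: (maxW [set y | exists w b, W w /\ y = w + u b * x]).
  - by move=> w Ww; exists w, 0; rewrite rmorph0 mul0r addr0.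
  - move=> a _ _ [w [b [Ww ->]]] [w' [b' [Ww' ->]]].
    exists (u a * w + w'), (a * b + b'); split; first exact: WD.
    by rewrite /op rmorphD rmorphM mulrDr mulrDl mulrA addrACA.
  - move=> _ -> [w [b [Ww E1]]]; have [b0|b0] := eqVneq b 0.
      by apply: W1; rewrite E1 b0 rmorph0 mul0r addr0.
    apply: nx; exists b^-1; suff -> : x - u b^-1 = u (- b^-1) * w by exact: WZ.
    have -> : x = u b^-1 * (1 - w).
      by rewrite [in 1 - w]E1 addrC addKr mulrA -rmorphM mulVf // rmorph1 mul1r.
    by rewrite mulrBr mulr1 addrC addKr rmorphN mulNr.
  - by exists 0, 1; rewrite rmorph1 mul1r add0r.
pose rho x := projT1 (cid (dec x)).
have rhoP x a : W (x - u a) -> rho x = a.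
  rewrite /rho; case: cid => b /= Wb Wa; apply/eqP; rewrite -subr_eq0.
  apply/negP => /negP ab; apply: W1.
  have -> : 1 = u (b - a)^-1 * (u (-1) * (x - u b) + (x - u a)).
    rewrite rmorphN rmorph1 mulN1r opprB addrA subrK -rmorphB -rmorphM.
    by rewrite mulVf // rmorph1.
  by apply: WZ; exact: WD.
have rhoW x : W (x - u (rho x)) by rewrite /rho; case: cid.
have rhoB : zmod_morphism rho.
  move=> x y; apply: rhoP.
  have -> : x - y - u (rho x - rho y) =
      u (-1) * (y - u (rho y)) + (x - u (rho x)).
    by rewrite rmorphN rmorph1 rmorphB; ring.
  exact: WD.
exists (HB.pack_for {additive E -> k0} rho
  (GRing.isZmodMorphism.Build E k0 rho rhoB)); split.
  move=> a x /=; apply: rhoP.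
  by rewrite rmorphM -mulrBr; exact: WZ.
by apply: rhoP; rewrite rmorph1 subrr.
Qed.

End LinearRetraction.

Section Amalgam.
Variables (k0 E1 E2 : fieldType).
Variables (u1 : {rmorphism k0 -> E1}) (u2 : {rmorphism k0 -> E2}).

(** In the tensor product of E1 and E2 over k0, the linear form [rho] on E1
yields the E2-linear map Phi that sends x (x) y to u2 (rho x) * y and 1 to 1.
The ring [A] of the proof has one variable per element of E2, so that the
tensor product is a quotient of it; the last two equations say that Phi factors
through this quotient. *)
Lemma exists_tensor_functional : exists (A : comNzRingType)
    (C : {rmorphism E1 -> A}) (X : E2 -> A) (Phi : {additive A -> E2}),
  [/\ Phi 1 = 1, forall g e, Phi (g * X e) = Phi g * e &
      forall g a, Phi (g * C (u1 a)) = Phi g * u2 a].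
Proof.
have [rho [rhoZ rho1]] := exists_retraction u1.
pose A := {malg E1[{cmonom E2}]}.
pose Phi : {additive A -> E2} :=
  GRing.Additive.clone _ _ (mmap (u2 \o rho) (cmeval (@id E2))) _.
have PhiU a m : Phi << a *g m >> = u2 (rho a) * cmeval (@id E2) m.
  exact: mmapU.
exists A, (GRing.RMorphism.clone _ _ (@malgC {cmonom E2} E1) _),
  (fun e => << ucm e >>), Phi; split.
- by rewrite [LHS]PhiU rho1 (rmorph1 u2) mmorph1 mulr1.
- move=> g e; rewrite [g in LHS](@monalgE {cmonom E2} E1).
  rewrite [g in RHS](@monalgE {cmonom E2} E1).
  rewrite [X in Phi X = _]mulr_suml (raddf_sum Phi).
  rewrite [X in _ = X * _](raddf_sum Phi).
  rewrite [RHS]mulr_suml; apply: eq_bigr => m _.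
  rewrite malgM_def fgmulUU [LHS]PhiU [X in _ = X * _]PhiU mulr1.
  by rewrite mmorphM /= cmevalU mulrA.
- move=> g a; rewrite [g in LHS](@monalgE {cmonom E2} E1).
  rewrite [g in RHS](@monalgE {cmonom E2} E1).
  rewrite [X in Phi X = _]mulr_suml (raddf_sum Phi).
  rewrite [X in _ = X * _](raddf_sum Phi).
  rewrite [RHS]mulr_suml; apply: eq_bigr => m _.
  rewrite malgM_def fgmulUU [LHS]PhiU [X in _ = X * _]PhiU.
  by rewrite mmorphM mmorph1 mulr1 (mulrC _ (u1 a)) rhoZ rmorphM -mulrA mulrC.
Qed.

Lemma annihilator_is_ideal (A : comNzRingType) (V : zmodType)
  (Phi : {additive A -> V}) : is_ideal [set p | forall g, Phi (g * p) = 0].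
Proof.
split=> [g|a p q Ip Iq g]; first by rewrite mulr0 raddf0.
by rewrite mulrDr raddfD mulrA Ip Iq addr0.
Qed.

(** The relations G present the tensor product of E1 and E2 over k0 as a
quotient of the polynomial ring [A] of [exists_tensor_functional].  They do not
generate 1, because Phi kills the ideal that they generate but not 1; a
homomorphism from the quotient to a field restricts to the wanted embeddings. *)
Lemma exists_amalgam : exists (L : fieldType)
  (v1 : {rmorphism E1 -> L}) (v2 : {rmorphism E2 -> L}),
  forall a, v1 (u1 a) = v2 (u2 a).
Proof.
have [A [C [X [Phi [Phi1 PhiX PhiC]]]]] := exists_tensor_functional.
pose G : set A :=
  [set p | (exists e e', p = X (e + e') - (X e + X e')) \/
           (exists e e', p = X (e * e') - X e * X e') \/
           p = X 1 - 1 \/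
           (exists a, p = X (u2 a) - C (u1 a))].
have G1 m : ~ ideal_gen G (1 ^+ m).
  rewrite expr1n => J1.
  suff /(_ 1) : forall g, Phi (g * 1) = 0.
    by rewrite mulr1 Phi1 => /eqP; rewrite oner_eq0.
  apply: (ideal_gen_sub (annihilator_is_ideal Phi) _ J1) => p.
  case=> [[e [e' ->]]|[[e [e' ->]]|[->|[a ->]]]] g.
  - by rewrite mulrBr mulrDr raddfB raddfD !PhiX -mulrDr subrr.
  - by rewrite mulrBr mulrA raddfB !PhiX mulrA subrr.
  - by rewrite mulrBr raddfB mulr1 PhiX mulr1 subrr.
  - by rewrite mulrBr raddfB PhiX PhiC subrr.
have [L [p [pG _]]] := exists_field_point G1.
pose v1 : {rmorphism E1 -> L} := GRing.RMorphism.clone _ _ (p \o C) _.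
pose v2 (e : E2) := p (X e).
have v2D e e' : v2 (e + e') = v2 e + v2 e'.
  apply/eqP; rewrite -subr_eq0 -!rmorphD -rmorphB pG //.
  by left; exists e, e'.
have v2M e e' : v2 (e * e') = v2 e * v2 e'.
  apply/eqP; rewrite -subr_eq0 -!rmorphM -rmorphB pG //.
  by right; left; exists e, e'.
have v21 : v2 1 = 1.
  apply/eqP; rewrite -subr_eq0 -(rmorph1 p) -rmorphB pG //.
  by right; right; left.
have v2u a : v1 (u1 a) = v2 (u2 a).
  apply/esym/eqP; rewrite -subr_eq0 -rmorphB pG //.
  by right; right; right; exists a.
have v2B : zmod_morphism v2.
  by move=> e e'; apply: (addIr (v2 e')); rewrite -v2D !subrK.
exists L, v1, (HB.pack_for {rmorphism E2 -> L} v2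
  (GRing.isZmodMorphism.Build E2 L v2 v2B)
  (GRing.isMonoidMorphism.Build E2 L v2 (conj v21 v2M))).
exact: v2u.
Qed.

End Amalgam.

(** * Extending an endomorphism of a field *)

Lemma exists_factor (R L S : comNzRingType) (p : {rmorphism R -> L})
    (q : {rmorphism R -> S}) :
  (forall z, exists x, p x = z) -> (forall x, p x = 0 -> q x = 0) ->
  exists r : {rmorphism L -> S}, forall x, r (p x) = q x.
Proof.
move=> ps pq; pose r z := q (projT1 (cid (ps z))).
have rp x : r (p x) = q x.
  rewrite /r; case: cid => y /= pyx; apply/eqP; rewrite -subr_eq0 -rmorphB.
  by apply/eqP/pq; rewrite rmorphB pyx subrr.
have rB : zmod_morphism r.
  move=> z w; have [[x <-] [y <-]] := (ps z, ps w).
  by rewrite -rmorphB !rp rmorphB.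
have rM : monoid_morphism r.
  split; first by rewrite -(rmorph1 p) rp rmorph1.
  move=> z w; have [[x <-] [y <-]] := (ps z, ps w).
  by rewrite -rmorphM !rp rmorphM.
by exists (HB.pack_for {rmorphism L -> S} r
  (GRing.isZmodMorphism.Build L S r rB)
  (GRing.isMonoidMorphism.Build L S r rM)).
Qed.

(** The direct limit of the tower K 0 -> K 1 -> ... is realised by sequences in
the product of the [K n] that follow the tower from some rank on, up to
equality from some rank on.  Since sequences are read rank by rank, elements
living at different levels are never compared through casts. *)
Section Germs.
Variables (K : nat -> fieldType) (i : forall n, {rmorphism K n -> K n.+1}).

Definition dprod : Type := forall n, K n.

HB.instance Definition _ := gen_eqMixin dprod.
HB.instance Definition _ := gen_choiceMixin dprod.

Definition dprod0 : dprod := fun=> 0.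
Definition dprod1 : dprod := fun=> 1.
Definition dprodN (x : dprod) : dprod := fun n => - x n.
Definition dprodD (x y : dprod) : dprod := fun n => x n + y n.
Definition dprodM (x y : dprod) : dprod := fun n => x n * y n.

Lemma dprod_ext (x y : dprod) : (forall n, x n = y n) -> x = y.
Proof. exact: functional_extensionality_dep. Qed.

Fact dprodDA : associative dprodD.
Proof. by move=> x y z; apply: dprod_ext => n; exact: addrA. Qed.
Fact dprodDC : commutative dprodD.
Proof. by move=> x y; apply: dprod_ext => n; exact: addrC. Qed.
Fact dprod0D : left_id dprod0 dprodD.
Proof. by move=> x; apply: dprod_ext => n; exact: add0r. Qed.
Fact dprodND : left_inverse dprod0 dprodN dprodD.
Proof. by move=> x; apply: dprod_ext => n; exact: addNr. Qed.
HB.instance Definition _ :=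
  GRing.isZmodule.Build dprod dprodDA dprodDC dprod0D dprodND.

Fact dprodMA : associative dprodM.
Proof. by move=> x y z; apply: dprod_ext => n; exact: mulrA. Qed.
Fact dprodMC : commutative dprodM.
Proof. by move=> x y; apply: dprod_ext => n; exact: mulrC. Qed.
Fact dprod1M : left_id dprod1 dprodM.
Proof. by move=> x; apply: dprod_ext => n; exact: mul1r. Qed.
Fact dprodMDl : left_distributive dprodM dprodD.
Proof. by move=> x y z; apply: dprod_ext => n; exact: mulrDl. Qed.
Fact dprod1_neq0 : dprod1 != 0.
Proof.
by apply/eqP => /(congr1 (fun x : dprod => x 0%N))/eqP; rewrite oner_eq0.
Qed.
HB.instance Definition _ := GRing.Zmodule_isComNzRing.Build dprod
  dprodMA dprodMC dprod1M dprodMDl dprod1_neq0.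

Definition coherent : {pred dprod} := fun x =>
  `[< exists N, forall n, (N <= n)%N -> i n (x n) = x n.+1 >].

Fact coherent_subring : subring_closed coherent.
Proof.
split=> [|x y|x y].
- by apply/asboolP; exists 0%N => n _; exact: rmorph1.
- move=> /asboolP[N xN] /asboolP[M yM]; apply/asboolP; exists (maxn N M) => n.
  by rewrite geq_max => /andP[/xN xn /yM yn]; rewrite [LHS]rmorphB xn yn.
- move=> /asboolP[N xN] /asboolP[M yM]; apply/asboolP; exists (maxn N M) => n.
  by rewrite geq_max => /andP[/xN xn /yM yn]; rewrite [LHS]rmorphM xn yn.
Qed.
HB.instance Definition _ :=
  GRing.isSubringClosed.Build dprod coherent coherent_subring.

Record germ := Germ { germ_val :> dprod; germP : germ_val \in coherent }.
HB.instance Definition _ := [isSub for germ_val].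
HB.instance Definition _ := [Choice of germ by <:].
HB.instance Definition _ := [SubChoice_isSubComNzRing of germ by <:].

Definition eventually0 : set germ :=
  [set x : germ | exists N, forall n, (N <= n)%N -> germ_val x n = 0].

(** A coherent sequence that does not vanish from some rank on vanishes nowhere
from its rank of coherence on, as the maps of the tower are injective; so it
can be inverted termwise. *)
Lemma exists_limit_field : exists (L : fieldType) (p : {rmorphism germ -> L}),
  (forall x : germ, p x = 0 <-> eventually0 x) /\
  (forall z, exists x : germ, p x = z).
Proof.
apply: exists_residue_field.
- split; first by exists 0%N.
  move=> a x y [N xN] [M yM]; exists (maxn N M) => n.
  rewrite geq_max => /andP[/xN xn /yM yn].
  rewrite -[LHS]/(germ_val a n * germ_val x n + germ_val y n) xn yn.
  by rewrite mulr0 addr0.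
- by move=> [N /(_ _ (leqnn N))/eqP]; rewrite oner_eq0.
move=> x nx; have /asboolP[N xN] := germP x.
have xn0 n : (N <= n)%N -> germ_val x n != 0.
  move=> Nn; apply/eqP => xn0; apply: nx; exists n => m.
  elim: m => [|m IHm]; first by rewrite leqn0 => /eqP n0; rewrite n0 in xn0.
  rewrite leq_eqVlt => /predU1P[<- //|]; rewrite ltnS => nm.
  by rewrite -xN ?(leq_trans Nn) // IHm // rmorph0.
pose y : dprod := fun n => (germ_val x n)^-1.
have yP : y \in coherent.
  by apply/asboolP; exists N => n Nn; rewrite [LHS]fmorphV xN.
exists (Germ yP), N => n Nn.
by rewrite -[LHS]/((germ_val x n)^-1 * germ_val x n - 1) mulVf ?subrr // xn0.
Qed.

End Germs.

Section GermShift.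
Variables (K : nat -> fieldType) (i s : forall n, {rmorphism K n -> K n.+1}).
Hypothesis is_comm : forall n a, i n.+1 (s n a) = s n.+1 (i n a).

(** Unital only from rank 1 on, since nothing is shifted into rank 0; this is
enough for germs. *)
Definition dprod_shift (x : dprod K) : dprod K :=
  fun n => if n is m.+1 then s m (x m) else 0.

Fact dprod_shift_coherent (x : germ i) : dprod_shift x \in coherent i.
Proof.
have /asboolP[N xN] := germP x; apply/asboolP; exists N.+1 => -[//|n] /= Nn.
by rewrite is_comm xN.
Qed.

Definition germ_shift (x : germ i) : germ i := Germ (dprod_shift_coherent x).

Fixpoint dprod_const (a : K 0) n : K n :=
  if n is m.+1 then i m (dprod_const a m) else a.

Fact dprod_constB a b n :
  dprod_const (a - b) n = dprod_const a n - dprod_const b n.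
Proof. by elim: n => //= n ->; rewrite rmorphB. Qed.

Fact dprod_const1 n : dprod_const 1 n = 1.
Proof. by elim: n => //= n ->; rewrite rmorph1. Qed.

Fact dprod_constM a b n :
  dprod_const (a * b) n = dprod_const a n * dprod_const b n.
Proof. by elim: n => //= n ->; rewrite rmorphM. Qed.

Fact dprod_const_coherent a : (dprod_const a : dprod K) \in coherent i.
Proof. by apply/asboolP; exists 0%N. Qed.

Definition germ_const (a : K 0) : germ i := Germ (dprod_const_coherent a).

Lemma germ_ext (x y : germ i) :
  (forall n, germ_val x n = germ_val y n) -> x = y.
Proof. by move=> xy; apply: val_inj; apply: functional_extensionality_dep. Qed.

(** The maps [s n] pass to the limit as an endomorphism.  Because [s] commutes
with [i], an equation between [s] and [i] at the bottom of the tower becomes an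
equation for this endomorphism. *)
Lemma exists_shift_limit : exists (L : fieldType) (sL : {rmorphism L -> L})
    (j : {rmorphism K 0 -> L}),
  forall a b, s 0%N a = i 0%N b -> sL (j a) = j b.
Proof.
have [L [p [p0 ps]]] := exists_limit_field i.
have pE x y N : (forall n, (N <= n)%N -> germ_val x n = germ_val y n) ->
    p x = p y.
  move=> xy; apply/eqP; rewrite -subr_eq0 -rmorphB; apply/eqP/p0.
  exists N => n /xy xyn; rewrite -[LHS]/(germ_val x n - germ_val y n) xyn.
  exact: subrr.
pose q := p \o germ_shift.
have qB : zmod_morphism q.
  move=> x y; rewrite /q /= -rmorphB; congr (p _); apply: germ_ext => -[|n].
    by rewrite -[RHS]/(0 - 0) subr0.
  exact: rmorphB.
have qM : monoid_morphism q.
  split.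
    rewrite /q /= -(rmorph1 p); apply: (@pE _ _ 1%N) => -[//|n] _.
    exact: rmorph1.
  move=> x y; rewrite /q /= -rmorphM; congr (p _); apply: germ_ext => -[|n].
    by rewrite -[RHS]/(0 * 0) mulr0.
  exact: rmorphM.
have [|sL sLp] := exists_factor (q := HB.pack_for {rmorphism germ i -> L} q
  (GRing.isZmodMorphism.Build (germ i) L q qB)
  (GRing.isMonoidMorphism.Build (germ i) L q qM)) ps.
  move=> x /p0[N xN]; rewrite -(rmorph0 p); apply: (@pE _ _ N.+1) => -[//|n] Nn.
  by rewrite /= xN // rmorph0.
pose j := p \o germ_const.
have jB : zmod_morphism j.
  move=> a b; rewrite /j /= -rmorphB; congr (p _); apply: germ_ext.
  exact: dprod_constB.
have jM : monoid_morphism j.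
  split=> [|a b].
    rewrite /j /= -(rmorph1 p); congr (p _); apply: germ_ext.
    exact: dprod_const1.
  rewrite /j /= -rmorphM; congr (p _); apply: germ_ext; exact: dprod_constM.
exists L, sL, (HB.pack_for {rmorphism K 0 -> L} j
  (GRing.isZmodMorphism.Build (K 0) L j jB)
  (GRing.isMonoidMorphism.Build (K 0) L j jM)) => a b sab.
rewrite /= /j /= sLp /= /q /=; apply: (@pE _ _ 1%N) => -[//|n] _ /=.
by elim: n => //= n IHn; rewrite -is_comm IHn.
Qed.

End GermShift.

(** A partial endomorphism: [shift] is defined on [lower] only, with values in
the larger field [upper]. *)
Record stage := Stage {
  lower : fieldType; upper : fieldType;
  incl : {rmorphism lower -> upper}; shift : {rmorphism lower -> upper} }.

(** Amalgamating two copies of [upper], embedded over [lower] by [shift] and by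
[incl], extends the partial endomorphism to [upper]. *)
Definition next_stage (S : stage) : stage :=
  let A := cid (exists_amalgam (shift S) (incl S)) in
  let v1 := cid (projT2 A) in
  let v2 := cid (projT2 v1) in
  @Stage (upper S) (projT1 A) (projT1 v1) (projT1 v2).

Lemma next_stage_comm (S : stage) a :
  incl (next_stage S) (shift S a) = shift (next_stage S) (incl S a).
Proof.
exact: (projT2 (cid (projT2 (cid (projT2 (cid
  (exists_amalgam (shift S) (incl S)))))))).
Qed.

(** An endomorphism of k extends to some field containing a given extension
E of k, although it need not extend to E itself. *)
Lemma exists_sigma_extension (k E : fieldType) (sigma_k : {rmorphism k -> k})
    (iota : {rmorphism k -> E}) :
  exists (L : fieldType) (sL : {rmorphism L -> L}) (j : {rmorphism E -> L}),
    forall c, sL (j (iota c)) = j (iota (sigma_k c)).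
Proof.
(* The first stage is defined on E: sigma_k extends to a map from E to K1. *)
have [K1 [v1 [v2 v12]]] :=
  exists_amalgam (GRing.RMorphism.clone _ _ (iota \o sigma_k) _) iota.
pose S n := iter n next_stage (Stage v1 v2).
have [|L [sL [j jP]]] := @exists_shift_limit (fun n => lower (S n))
  (fun n => incl (S n)) (fun n => shift (S n)).
  by move=> n a; exact: next_stage_comm.
by exists L, sL, j => c; apply: jP; rewrite /= -v12.
Qed.

(** * Hurwitz series *)

(** The sequence x stands for the power series sum_n x_n t^n / n!. *)
Section Hurwitz.
Variable L : comNzRingType.

Definition hurwitz : Type := nat -> L.

HB.instance Definition _ := GRing.Zmodule.copy hurwitz (nat -> L).

Definition hshift (x : hurwitz) : hurwitz := fun n => x n.+1.

(** The coefficient at n of the product, which is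
sum_i 'C(n, i) x_i y_(n - i).  The recursion is the Leibniz rule for the shift,
so that this rule holds by definition, and each ring axiom follows from its
value at 0 by induction on n, without sums of binomials. *)
Fixpoint hcoef n (x y : hurwitz) : L :=
  if n is m.+1 then hcoef m (hshift x) y + hcoef m x (hshift y)
  else x 0%N * y 0%N.

Definition hmul (x y : hurwitz) : hurwitz := fun n => hcoef n x y.
Definition hone : hurwitz := fun n => (n == 0%N)%:R.

Fact hcoefC n x y : hcoef n x y = hcoef n y x.
Proof.
elim: n x y => [|n IHn] x y /=; first exact: mulrC.
by rewrite (IHn _ y) (IHn x) addrC.
Qed.

Fact hcoefDl n x y z : hcoef n (x + y) z = hcoef n x z + hcoef n y z.
Proof.
elim: n x y z => [|n IHn] x y z /=; first exact: mulrDl.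
by rewrite -[hshift (x + y)]/(hshift x + hshift y) !IHn addrACA.
Qed.

Fact hcoefA n x y z : hcoef n x (hmul y z) = hcoef n (hmul x y) z.
Proof.
elim: n x y z => [|n IHn] x y z /=; first exact: mulrA.
rewrite -[hshift (hmul y z)]/(hmul (hshift y) z + hmul y (hshift z)).
rewrite -[hshift (hmul x y)]/(hmul (hshift x) y + hmul x (hshift y)).
by rewrite hcoefDl (hcoefC n x) hcoefDl !(hcoefC n _ x) !IHn !addrA.
Qed.

Fact hcoef0 n x : hcoef n 0 x = 0.
Proof. by elim: n x => [|n IHn] x /=; [exact: mul0r | rewrite !IHn addr0]. Qed.

Fact hcoef1 n x : hcoef n hone x = x n.
Proof.
elim: n x => [|n IHn] x /=; first exact: mul1r.
by rewrite IHn -[hshift hone]/(0 : hurwitz) hcoef0 add0r.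
Qed.

Fact hmulA : associative hmul.
Proof. by move=> x y z; apply/funext => n; exact: hcoefA. Qed.
Fact hmulC : commutative hmul.
Proof. by move=> x y; apply/funext => n; exact: hcoefC. Qed.
Fact hmul1 : left_id hone hmul.
Proof. by move=> x; apply/funext => n; exact: hcoef1. Qed.
Fact hmulDl : left_distributive hmul +%R.
Proof. by move=> x y z; apply/funext => n; exact: hcoefDl. Qed.
Fact hone_neq0 : hone != 0.
Proof.
by apply/eqP => /(congr1 (fun x : hurwitz => x 0%N))/eqP; rewrite oner_eq0.
Qed.

HB.instance Definition _ := GRing.Zmodule_isComNzRing.Build hurwitz
  hmulA hmulC hmul1 hmulDl hone_neq0.

End Hurwitz.

Section HurwitzDomain.
Variable L : fieldType.
Implicit Types x y : hurwitz L.

Lemma hcoef_lt n p q x y :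
  (forall i, (i < p)%N -> x i = 0) -> (forall j, (j < q)%N -> y j = 0) ->
  (n < p + q)%N -> hcoef n x y = 0.
Proof.
elim: n p q x y => [|n IHn] p q x y x0 y0 npq /=.
  case: p x0 npq => [|p] x0 npq; last by rewrite x0 ?mul0r.
  by rewrite y0 ?mulr0.
rewrite (IHn p.-1 q) ?(IHn p q.-1) ?addr0 //; try by lia.
  by move=> j jq; apply: y0; lia.
by move=> j jp; apply: x0; lia.
Qed.

(** The lowest coefficient of a product.  The binomial is the reason for the
hypothesis of characteristic zero in [hurwitz_domain]. *)
Lemma hcoef_lead p q x y :
  (forall i, (i < p)%N -> x i = 0) -> (forall j, (j < q)%N -> y j = 0) ->
  hcoef (p + q) x y = 'C(p + q, p)%:R * (x p * y q).
Proof.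
move: {2}(p + q)%N (erefl (p + q)%N) => n.
elim: n p q x y => [|n IHn] p q x y pqn x0 y0.
  by move: pqn; case: p x0 => // _; case: q y0 => // _ _; rewrite mul1r.
have xS : forall i, (i < p.-1)%N -> hshift x i = 0.
  by move=> i ip; apply: x0; lia.
have yS : forall j, (j < q.-1)%N -> hshift y j = 0.
  by move=> j jq; apply: y0; lia.
case: p q pqn x0 y0 xS yS => [|p] [|q] //= [pqn] x0 y0 xS yS.
- rewrite (hcoef_lt (p := 0) (q := q.+1)) // add0r.
  by rewrite -[q in LHS]add0n IHn // !bin0.
- rewrite [X in _ + X](hcoef_lt (p := p.+1) (q := 0)) ?addr0 //.
  by rewrite IHn // !addn0 !binn.
rewrite IHn // -addSnnS IHn; [|by lia|by []|by []].
by rewrite addnS binS natrD mulrDl addrC.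
Qed.

Hypothesis char0 : [pchar L] =i pred0.

Lemma hurwitz_domain x y : x * y = 0 -> (x == 0) || (y == 0).
Proof.
have ord (z : hurwitz L) : z != 0 ->
    exists p, z p != 0 /\ forall i, (i < p)%N -> z i = 0.
  move=> z0; have ez : exists p, z p != 0.
    apply: contrapT => nz; case/eqP: z0; apply/funext => p; apply/eqP.
    by apply/negPn/negP => zp; apply: nz; exists p.
  case: (ex_minnP ez) => p zp minp; exists p; split=> // i ip; apply/eqP.
  by apply: contraTT ip => /minp; rewrite -leqNgt.
move=> xy0; apply: contraT; rewrite negb_or => /andP[/ord[p [xp xlt]]].
move=> /ord[q [yq ylt]].
have := hcoef_lead xlt ylt; rewrite -[hcoef _ _ _]/((x * y) (p + q)%N) xy0.
move=> /esym/eqP; rewrite !mulf_eq0 (negPf xp) (negPf yq) !orbF.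
by rewrite (pcharf0P L).1 // -leqn0 leqNgt bin_gt0 leq_addr.
Qed.

End HurwitzDomain.

(** * Derivation and endomorphism of a fraction field *)

Section FractionDS.
Variables (D : idomainType) (d : D -> D) (s : {rmorphism D -> D}).
Hypothesis dD : {morph d : x y / x + y}.
Hypothesis dM : forall x y, d (x * y) = d x * y + x * d y.
Hypothesis s_inj : injective s.
Hypothesis dsC : forall x, d (s x) = s (d x).

Local Notation "x %:F" := (@FracField.tofrac D x).
Implicit Types (a b : D) (z w : {fraction D}).

Lemma fractionP z : exists r : D * D, r.2 != 0 /\ z = r.1%:F / r.2%:F.
Proof.
elim/quotW: z => r; have d0 := denom_ratioP r.
exists (val r); split=> //; apply: (canRL (mulfK _)).
  by rewrite tofrac_eq0.
unlock FracField.tofrac; rewrite -[LHS]FracField.pi_mul /FracField.mulf.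
rewrite !numden_Ratio ?oner_eq0 ?mulr1 //; apply/eqmodP => /=.
by rewrite FracField.equivfE !numden_Ratio ?oner_eq0 // mulr1 mulrC.
Qed.

Definition frac_delta z : {fraction D} :=
  let r := projT1 (cid (fractionP z)) in
  (d r.1 * r.2 - r.1 * d r.2)%:F / (r.2 ^+ 2)%:F.

Definition frac_sigma z : {fraction D} :=
  let r := projT1 (cid (fractionP z)) in (s r.1)%:F / (s r.2)%:F.

(** The quotient rule does not depend on the chosen representation: apply [d]
to the equality of cross products. *)
Lemma frac_deltaE a b : b != 0 ->
  frac_delta (a%:F / b%:F) = (d a * b - a * d b)%:F / (b ^+ 2)%:F.
Proof.
move=> b0; rewrite /frac_delta; case: cid => -[a' b'] /= [b'0].
move/eqP; rewrite eqr_div ?tofrac_eq0 // -!tofracM tofrac_eq => /eqP ab.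
apply/eqP; rewrite eqr_div ?tofrac_eq0 ?expf_neq0 // -!tofracM tofrac_eq.
apply/eqP; have := congr1 d ab; rewrite !dM => dab.
have E1 : d a' * b = d a * b' + a * d b' - a' * d b by rewrite dab addrK.
transitivity (b * b' * (d a' * b) - (a' * b) * b * d b'); first by ring.
rewrite -ab E1.
transitivity (b' ^+ 2 * b * d a - (a' * b) * b' * d b); first by ring.
by rewrite -ab; ring.
Qed.

Lemma frac_sigmaE a b : b != 0 ->
  frac_sigma (a%:F / b%:F) = (s a)%:F / (s b)%:F.
Proof.
move=> b0; rewrite /frac_sigma; case: cid => -[a' b'] /= [b'0].
move/eqP; rewrite eqr_div ?tofrac_eq0 // -!tofracM tofrac_eq => /eqP ab.
apply/eqP; rewrite eqr_div ?tofrac_eq0 ?(raddf_eq0 _ s_inj) // -!tofracM.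
by rewrite tofrac_eq -!rmorphM ab.
Qed.

Lemma frac_deltaD : {morph frac_delta : z w / z + w}.
Proof.
move=> z w; have [[a b] /= [b0 ->]] := fractionP z.
have [[a' b'] /= [b'0 ->]] := fractionP w.
have -> : a%:F / b%:F + a'%:F / b'%:F = (a * b' + a' * b)%:F / (b * b')%:F.
  by rewrite addf_div ?tofrac_eq0 // rmorphD !rmorphM.
rewrite !frac_deltaE ?mulf_neq0 // addf_div ?tofrac_eq0 ?expf_neq0 //.
rewrite -!tofracM -tofracD -exprMn; congr (_%:F / _).
by rewrite dD !dM; ring.
Qed.

Lemma frac_deltaM z w :
  frac_delta (z * w) = frac_delta z * w + z * frac_delta w.
Proof.
have [[a b] /= [b0 ->]] := fractionP z.
have [[a' b'] /= [b'0 ->]] := fractionP w.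
rewrite mulf_div -!tofracM !frac_deltaE ?mulf_neq0 // !mulf_div.
rewrite addf_div ?mulf_neq0 ?tofrac_eq0 ?expf_neq0 //.
rewrite -!tofracM -tofracD; apply/eqP.
rewrite eqr_div ?tofrac_eq0 ?mulf_neq0 ?expf_neq0 // -!tofracM tofrac_eq.
by apply/eqP; rewrite !dM; ring.
Qed.

Lemma frac_sigmaD : {morph frac_sigma : z w / z + w}.
Proof.
move=> z w; have [[a b] /= [b0 ->]] := fractionP z.
have [[a' b'] /= [b'0 ->]] := fractionP w.
have -> : a%:F / b%:F + a'%:F / b'%:F = (a * b' + a' * b)%:F / (b * b')%:F.
  by rewrite addf_div ?tofrac_eq0 // rmorphD !rmorphM.
rewrite !frac_sigmaE ?mulf_neq0 // addf_div ?tofrac_eq0 ?(raddf_eq0 _ s_inj) //.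
by rewrite -!tofracM -tofracD -!rmorphM -rmorphD.
Qed.

Lemma frac_sigmaM : {morph frac_sigma : z w / z * w}.
Proof.
move=> z w; have [[a b] /= [b0 ->]] := fractionP z.
have [[a' b'] /= [b'0 ->]] := fractionP w.
rewrite mulf_div -!tofracM !frac_sigmaE ?mulf_neq0 //.
by rewrite mulf_div -!tofracM -!rmorphM.
Qed.

Lemma frac_sigma_tofrac a : frac_sigma a%:F = (s a)%:F.
Proof.
rewrite -[a%:F]divr1 -tofrac1 frac_sigmaE ?oner_eq0 //.
by rewrite rmorph1 tofrac1 divr1.
Qed.

Lemma frac_delta_tofrac a : frac_delta a%:F = (d a)%:F.
Proof.
have d1 : d 1 = 0.
  by apply: (addrI (d 1)); rewrite addr0 -[in RHS](mulr1 1) dM mulr1 mul1r.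
rewrite -[a%:F]divr1 -tofrac1 frac_deltaE ?oner_eq0 //.
by rewrite d1 mulr0 mulr1 subr0 expr1n tofrac1 divr1.
Qed.

Lemma frac_sigma1 : frac_sigma 1 = 1.
Proof. by rewrite -tofrac1 frac_sigma_tofrac rmorph1. Qed.

Lemma frac_deltaC z : frac_delta (frac_sigma z) = frac_sigma (frac_delta z).
Proof.
have [[a b] /= [b0 ->]] := fractionP z.
rewrite frac_sigmaE // !frac_deltaE ?(raddf_eq0 _ s_inj) //.
rewrite frac_sigmaE ?expf_neq0 //; by rewrite !dsC (rmorphB s) !(rmorphM s).
Qed.

End FractionDS.

(** * Taylor expansion *)

Definition hdomain (L : fieldType) (char0 : [pchar L] =i pred0) : idomainType :=
  domain_of (hurwitz_domain char0).

(** The carrier does not mention [s], but its structure of difference ring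
does: [s] is an argument so that the structure is determined by the type. *)
Definition laurent (L : fieldType) (s : {rmorphism L -> L})
  (char0 : [pchar L] =i pred0) : Type := {fraction hdomain char0}.

HB.instance Definition _ L s char0 := GRing.Field.on (@laurent L s char0).

Section Laurent.
Variables (L : fieldType) (s : {rmorphism L -> L}).
Hypothesis char0 : [pchar L] =i pred0.
Local Notation laurent := (laurent s char0).
Local Notation hdomain := (hdomain char0).

Definition hsigma (x : hurwitz L) : hurwitz L := fun n => s (x n).

Fact hsigma_is_zmod_morphism : zmod_morphism hsigma.
Proof. by move=> x y; apply/funext => n; exact: rmorphB. Qed.

Fact hcoef_sigma n (x y : hurwitz L) :
  s (hcoef n x y) = hcoef n (hsigma x) (hsigma y).
Proof.
elim: n x y => [|n IHn] x y /=; first exact: rmorphM.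
by rewrite rmorphD !IHn.
Qed.

Fact hsigma_is_monoid_morphism : monoid_morphism hsigma.
Proof.
split=> [|x y]; apply/funext => n; last exact: hcoef_sigma.
exact: rmorph_nat.
Qed.

HB.instance Definition _ := GRing.isZmodMorphism.Build
  (hurwitz L) (hurwitz L) hsigma hsigma_is_zmod_morphism.
HB.instance Definition _ := GRing.isMonoidMorphism.Build
  (hurwitz L) (hurwitz L) hsigma hsigma_is_monoid_morphism.

Lemma hsigma_inj : injective hsigma.
Proof.
move=> x y xy; apply/funext => n; apply: (fmorph_inj s).
exact: (congr1 (fun z : hurwitz L => z n) xy).
Qed.

Definition hdelta : hdomain -> hdomain := @hshift L.
Definition hdsigma : {rmorphism hdomain -> hdomain} := hsigma.

Definition to_laurent : {rmorphism hurwitz L -> laurent} :=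
  (@FracField.tofrac hdomain : {rmorphism hdomain -> {fraction hdomain}}).

Fact hdeltaD : {morph hdelta : x y / x + y}. Proof. by []. Qed.
Fact hdeltaM x y : hdelta (x * y) = hdelta x * y + x * hdelta y.
Proof. by []. Qed.
Fact hdeltaC x : hdelta (hdsigma x) = hdsigma (hdelta x). Proof. by []. Qed.
Fact hdsigma_inj : injective hdsigma. Proof. exact: hsigma_inj. Qed.

HB.instance Definition _ := isDSRing.Build laurent
  (frac_deltaD hdeltaD hdeltaM) (frac_deltaM hdeltaM)
  (frac_sigmaD hdsigma_inj) (frac_sigmaM hdsigma_inj)
  (frac_sigma1 hdsigma_inj) (frac_deltaC hdeltaM hdsigma_inj hdeltaC).

Lemma to_laurent_delta x : to_laurent (hshift x) = delta (to_laurent x).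
Proof. exact/esym/(frac_delta_tofrac hdeltaM). Qed.

Lemma to_laurent_sigma x : to_laurent (hsigma x) = sigma (to_laurent x).
Proof. exact/esym/(frac_sigma_tofrac hdsigma_inj). Qed.

Lemma to_laurent_eq0 x : to_laurent x = 0 -> x = 0.
Proof. by move=> /eqP; rewrite tofrac_eq0 => /eqP. Qed.

Lemma laurent_sigma_id : (forall a, s a = a) -> forall z : laurent, sigma z = z.
Proof.
move=> sid z; have [[a b] /= [b0 ->]] := fractionP z.
have hid x : hdsigma x = x by apply/funext => n; exact: sid.
by rewrite -[LHS]/(frac_sigma hdsigma _) (frac_sigmaE hdsigma_inj) // !hid.
Qed.

End Laurent.

(** The Taylor map turns a mere ring homomorphism [q] from a differential ring
into one that commutes with the derivations. *)
Section Taylor.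
Variables (S : dsRingType) (L : comNzRingType) (q : {rmorphism S -> L}).

Definition taylor (g : S) : hurwitz L := fun n => q (iter n (@delta S) g).

Fact taylor_is_zmod_morphism : zmod_morphism taylor.
Proof.
move=> g h; apply/funext => n; rewrite -[RHS]/(q _ - q _) -rmorphB.
by congr (q _); elim: n => //= n ->; rewrite raddfB.
Qed.

HB.instance Definition _ := GRing.isZmodMorphism.Build
  S (hurwitz L) taylor taylor_is_zmod_morphism.

Lemma taylor_delta g : taylor (delta g) = hshift (taylor g).
Proof. by apply/funext => n; rewrite /taylor -iterSr. Qed.

Fact hcoef_taylor n g h : hcoef n (taylor g) (taylor h) = taylor (g * h) n.
Proof.
elim: n g h => [|n IHn] g h; first by rewrite /taylor /= rmorphM.
rewrite /= -!taylor_delta !IHn -[RHS]/(hshift (taylor (g * h)) n).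
by rewrite -taylor_delta deltaM raddfD.
Qed.

Fact taylor_is_monoid_morphism : monoid_morphism taylor.
Proof.
split=> [|g h]; last by apply/funext => n; rewrite -hcoef_taylor.
apply/funext => -[|n]; first exact: rmorph1.
rewrite /taylor iterSr delta1 -[RHS](rmorph0 q); congr (q _).
by elim: n => //= n ->; rewrite raddf0.
Qed.

HB.instance Definition _ := GRing.isMonoidMorphism.Build
  S (hurwitz L) taylor taylor_is_monoid_morphism.

End Taylor.

Lemma iter_delta_sigma (R : dsRingType) e m (x : R) :
  iter e (@delta R) (iter m (@sigma R) x) =
  iter m (@sigma R) (iter e (@delta R) x).
Proof.
elim: e => //= e ->; elim: m (iter e _ x) => //= m IHm y.
by rewrite delta_sigma IHm.
Qed.

Lemma iter_delta_coef (k : dsNzRingType) n m (c : k) :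
  iter m (@delta (dspoly k n)) (dspolyC n c) = dspolyC n (iter m (@delta k) c).
Proof.
by elim: m => [//|m IHm]; rewrite [LHS]iterS IHm; exact: dspoly_deltaC.
Qed.

(** * Sequence solutions from ring homomorphisms *)

(** [ev r] is the intended value of sigma^r g at t = 0, for g in k{y}. *)
Section SequencePoint.
Variables (k : dsiFieldType) (n : nat) (L : fieldType) (s : {rmorphism L -> L}).
Hypothesis char0 : [pchar k] =i pred0.
Variables (q : {rmorphism k -> L}) (ev : int -> {rmorphism dspoly k n -> L}).
Hypothesis q_sigma : forall c, s (q c) = q (sigma c).
Hypothesis ev_coef : forall r c, ev r (dspolyC n c) = q (sigmaZ r c).
Hypothesis ev_sigma : forall r g, ev r (sigma g) = ev (r + 1) g.

Let charL : [pchar L] =i pred0.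
Proof. by move=> p; rewrite (fmorph_pchar q) char0. Qed.

(** The map that sends g to the sequence of the Taylor expansions along the
[ev r] is a delta-sigma-homomorphism over k, hence the evaluation at the
sequences of the expansions of the [y_l]. *)
Lemma exists_sequence_point : exists (K : dsFieldType)
    (iota : {dsmorphism k -> K}) (a : 'I_n -> zseq K),
  (forall g, vanishes_at iota a g <->
    forall r m, ev r (iter m (@delta _) g) = 0) /\
  ((forall x, s x = x) -> forall x : K, sigma x = x).
Proof.
pose K : dsFieldType := laurent s charL.
pose iota0 (c : k) : K := to_laurent s charL (taylor q c).
have iotaB : zmod_morphism iota0 by move=> c c'; rewrite /iota0 !raddfB.
have iotaM : monoid_morphism iota0.
  by split=> [|c c']; rewrite /iota0 ?(rmorph1, rmorphM).
have iotaP : isDSMorphism k K iota0.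
  split=> c; rewrite /iota0 /=; first by rewrite taylor_delta to_laurent_delta.
  rewrite -to_laurent_sigma; congr (to_laurent _ _ _); apply/funext => m.
  rewrite /taylor /hsigma q_sigma; congr (q _).
  exact: (iter_delta_sigma m 1).
pose iota : {dsmorphism k -> K} := HB.pack_for {dsmorphism k -> K} iota0
  (GRing.isZmodMorphism.Build k K iota0 iotaB)
  (GRing.isMonoidMorphism.Build k K iota0 iotaM) iotaP.
pose phi (g : dspoly k n) : zseq K :=
  fun r => to_laurent s charL (taylor (ev r) g).
have phiB : zmod_morphism phi.
  by move=> g h; apply/funext => r; rewrite /phi !raddfB.
have phiM : monoid_morphism phi.
  by split=> [|g h]; apply/funext => r; rewrite /phi ?(rmorph1, rmorphM).
have phiDS : isDSMorphism (dspoly k n) (zseq K) phi.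
  split=> g; apply/funext => r; rewrite /phi.
    by rewrite taylor_delta to_laurent_delta.
  rewrite -[RHS]/(to_laurent s charL (taylor (ev (r + 1)) g)).
  congr (to_laurent _ _ _); apply/funext => m.
  rewrite /taylor -ev_sigma; congr (ev _ _).
  exact: (iter_delta_sigma m 1).
pose Phi : {dsmorphism dspoly k n -> zseq K} :=
  HB.pack_for {dsmorphism dspoly k n -> zseq K} phi
   (GRing.isZmodMorphism.Build (dspoly k n) (zseq K) phi phiB)
   (GRing.isMonoidMorphism.Build (dspoly k n) (zseq K) phi phiM) phiDS.
pose a l := Phi (dspolyY k l).
have PhiE : Phi =1 dspoly_eval iota a.
  apply: dspoly_evalP => // c; apply/funext => r; rewrite /zseqC.
  rewrite -[LHS]/(to_laurent s charL (taylor (ev r) (dspolyC n c))).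
  rewrite -[RHS]/(to_laurent s charL (taylor q (sigmaZ r c))).
  congr (to_laurent _ _ _); apply/funext => m; rewrite /taylor.
  transitivity (ev r (dspolyC n (iter m (@delta k) c))).
    by congr (ev r _); exact: iter_delta_coef.
  rewrite ev_coef; congr (q _).
  by elim: m => //= m IHm; rewrite -delta_sigmaZ IHm.
exists K, iota, a; split; last exact: laurent_sigma_id.
move=> g; rewrite /vanishes_at -PhiE; split=> [g0 r m|g0].
  have /to_laurent_eq0 := congr1 (fun z : zseq K => z r) g0.
  by move=> /(congr1 (fun x : hurwitz L => x m)).
apply/funext => r; rewrite -[RHS](rmorph0 (to_laurent s charL)).
by congr (to_laurent _ _ _); apply/funext => m; exact: g0.
Qed.

End SequencePoint.

(** * Polynomials in integer shifts of the unknowns *)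

Section PolyEval.
Variables (I : choiceType) (R S : comNzRingType).
Variables (c : {rmorphism R -> S}) (x : I -> S).

Definition peval : {malg R[{cmonom I}]} -> S := mmap c (cmeval x).

HB.instance Definition _ := GRing.RMorphism.copy peval (mmap c (cmeval x)).

Lemma pevalC a : peval (malgC a) = c a.
Proof. exact: mmapC. Qed.

Lemma pevalX v : peval << ucm v >> = x v.
Proof. by rewrite /peval mmapU cmevalU /= (rmorph1 c) mul1r. Qed.

End PolyEval.

Section SigmaZ.
Variable k : dsiFieldType.

Fact sigmaZ_is_zmod_morphism r : zmod_morphism (@sigmaZ k r).
Proof. by move=> x y; apply: (addIr (sigmaZ r y)); rewrite -sigmaZD !subrK. Qed.

Fact sigmaZ_is_monoid_morphism r : monoid_morphism (@sigmaZ k r).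
Proof. by split; [exact: sigmaZ1 | exact: sigmaZM]. Qed.

HB.instance Definition _ r := GRing.isZmodMorphism.Build k k (@sigmaZ k r)
  (sigmaZ_is_zmod_morphism r).
HB.instance Definition _ r := GRing.isMonoidMorphism.Build k k (@sigmaZ k r)
  (sigmaZ_is_monoid_morphism r).

Lemma sigmaZ_add i j (x : k) : sigmaZ (i + j) x = sigmaZ i (sigmaZ j x).
Proof.
elim/int_rect: j x => [|j IHj|j IHj] x; first by rewrite addr0.
  by rewrite intS (addrC 1) addrA !sigmaZS IHj.
rewrite -[x](sigmaVK (s := k)) -!sigmaZS.
have -> : - j.+1%:Z + 1 = - j%:Z by lia.
have -> : i - j.+1%:Z + 1 = i - j%:Z by lia.
exact: IHj.
Qed.

End SigmaZ.

Section IterSigma.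
Variables (R : dsRingType) (N : nat).

Fact iter_sigma_is_zmod_morphism : zmod_morphism (iter N (@sigma R)).
Proof. by move=> x y; elim: N => //= m ->; rewrite rmorphB. Qed.

Fact iter_sigma_is_monoid_morphism : monoid_morphism (iter N (@sigma R)).
Proof.
split=> [|x y]; first by elim: N => //= m ->; rewrite rmorph1.
by elim: N => //= m ->; rewrite rmorphM.
Qed.

Definition iter_sigma : {rmorphism R -> R} :=
  HB.pack_for {rmorphism R -> R} (iter N (@sigma R))
    (GRing.isZmodMorphism.Build R R _ iter_sigma_is_zmod_morphism)
    (GRing.isMonoidMorphism.Build R R _ iter_sigma_is_monoid_morphism).

End IterSigma.

Section Inversive.
Variables (k : dsiFieldType) (n : nat).

(** (i, j, l) stands for delta^i sigma^j y_l with j possibly negative. *)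
Definition zvar : choiceType := (nat * int * 'I_n)%type.
Definition zpoly : comNzRingType := {malg k[{cmonom zvar}]}.

Definition zvar_shift (r : int) (v : dsvar n) : zvar :=
  (v.1.1, v.1.2%:Z + r, v.2).

Definition zpolyC : {rmorphism k -> zpoly} :=
  GRing.RMorphism.clone _ _ (@malgC {cmonom zvar} k) _.

Definition zpolyX (v : zvar) : zpoly := << ucm v >>.

(** sigma^r, as a map from k{y} to its extension with negative shifts. *)
Definition tau (r : int) : {rmorphism dspoly k n -> zpoly} :=
  GRing.RMorphism.clone (dspoly k n) zpoly
   (peval (GRing.RMorphism.clone _ _ (zpolyC \o @sigmaZ k r) _)
     (zpolyX \o zvar_shift r)) _.

Lemma tauC r c : tau r (dspolyC n c) = zpolyC (sigmaZ r c).
Proof. exact: pevalC. Qed.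

Lemma tauX r v : tau r (dspolyX k v) = zpolyX (zvar_shift r v).
Proof. exact: pevalX. Qed.

(** sigma^N on the variables whose shift stays nonnegative.  The value 0 on the
other ones makes [rho N] a ring homomorphism on the whole ring; a given
polynomial contains none of them once N is large. *)
Definition rho_var (N : nat) (v : zvar) : dspoly k n :=
  if v.1.2 + N%:Z is Posz j then dspolyX k (v.1.1, j, v.2) else 0.

Definition rho (N : nat) : {rmorphism zpoly -> dspoly k n} :=
  GRing.RMorphism.clone zpoly (dspoly k n)
   (peval (GRing.RMorphism.clone _ _ (@dspolyC k n \o @sigmaZ k N%:Z) _)
     (rho_var N)) _.

Lemma rhoC N c : rho N (zpolyC c) = dspolyC n (sigmaZ N%:Z c).
Proof. exact: pevalC. Qed.

Lemma rhoX N v : rho N (zpolyX v) = rho_var N v.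
Proof. exact: pevalX. Qed.

Lemma dspoly_rmorph_ext (S : comNzRingType)
    (p q : {rmorphism dspoly k n -> S}) :
  (forall c, p (dspolyC n c) = q (dspolyC n c)) ->
  (forall v, p (dspolyX k v) = q (dspolyX k v)) -> p =1 q.
Proof.
move=> pqC pqX; elim/dspoly_ind=> // g h IHg IHh.
  by rewrite [LHS](rmorphD p) [RHS](rmorphD q); exact: (f_equal2 +%R IHg IHh).
by rewrite [LHS](rmorphM p) [RHS](rmorphM q); exact: (f_equal2 *%R IHg IHh).
Qed.

Lemma tau_sigma r g : tau r (sigma g) = tau (r + 1) g.
Proof.
pose p : {rmorphism dspoly k n -> zpoly} :=
  GRing.RMorphism.clone _ _ (tau r \o @dspoly_sigma k n) _.
apply: (@dspoly_rmorph_ext zpoly p (tau (r + 1)) _ _ g) => [c|v].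
- rewrite -[LHS]/(tau r (dspoly_sigma (dspolyC n c))).
  by rewrite [X in tau r X = _]dspoly_sigmaC [LHS]tauC [RHS]tauC sigmaZS.
- rewrite -[LHS]/(tau r (dspoly_sigma (dspolyX k v))).
  rewrite [X in tau r X = _]dspoly_sigmaX [LHS]tauX [RHS]tauX.
  congr zpolyX; rewrite /zvar_shift /=; congr (_, _, _); lia.
Qed.

Lemma rho_tau N r m g : N%:Z + r = m%:Z ->
  rho N (tau r g) = iter m (@sigma (dspoly k n)) g.
Proof.
move=> Nrm; pose p : {rmorphism dspoly k n -> dspoly k n} :=
  GRing.RMorphism.clone _ _ (rho N \o tau r) _.
apply: (@dspoly_rmorph_ext _ p (iter_sigma (dspoly k n) m) _ _ g) => [c|v].
- rewrite -[LHS]/(rho N (tau r (dspolyC n c))) [X in rho N X = _]tauC [LHS]rhoC.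
  rewrite -sigmaZ_add Nrm /=; elim: m {Nrm} => //= m IHm.
  by rewrite -[RHS](congr1 (@sigma (dspoly k n)) IHm); exact/esym/dspoly_sigmaC.
- rewrite -[LHS]/(rho N (tau r (dspolyX k v))) [X in rho N X = _]tauX [LHS]rhoX.
  rewrite /rho_var /= -addrA (addrC r) Nrm /=.
  case: v => [[e j] l] /=; elim: m {Nrm} => [|m IHm]; first by rewrite addn0.
  rewrite -[RHS](congr1 (@sigma (dspoly k n)) IHm) addnS.
  exact/esym/dspoly_sigmaX.
Qed.

Section Descent.
Variables (F : set (dspoly k n)) (f : dspoly k n).

Definition shifts : set zpoly :=
  [set h | exists r e, exists2 g, F g &
    h = tau r (iter e (@delta (dspoly k n)) g)].

(** The elements that a large enough [rho N] sends into the
difference-differential ideal of F form an ideal, so the generators suffice. *)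
Lemma diff_ideal_of_shifted x : ideal_gen shifts x ->
  exists N0, forall N, (N0 <= N)%N -> diff_ideal (sigma_orbit F) (rho N x).
Proof.
set J := diff_ideal (sigma_orbit F).
have iJ : is_ideal J by exact: ideal_gen_is_ideal.
apply: (@ideal_gen_sub _ _
  [set x | exists N0, forall N, (N0 <= N)%N -> J (rho N x)]).
  split; first by exists 0%N => N _; rewrite rmorph0; exact: iJ.1.
  move=> a y z [N1 J1] [N2 J2]; exists (maxn N1 N2) => N.
  rewrite geq_max => /andP[/J1 Jy /J2 Jz].
  by rewrite rmorphD rmorphM; exact: iJ.2.
move=> _ [r [e [g Fg ->]]]; exists `|r|%N => N rN.
have [m Nrm] : exists m, N%:Z + r = m%:Z by exists (absz (N%:Z + r)); lia.
rewrite (rho_tau _ Nrm); apply: ideal_gen_mem.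
exists e, (iter m (@sigma (dspoly k n)) g); first by exists m, g.
by rewrite iter_delta_sigma.
Qed.

(** The exponents of f and of sigma can be increased separately, hence made
equal. *)
Lemma descent m : ideal_gen shifts (tau 0 f ^+ m) ->
  exists m, diff_ideal (sigma_orbit F) (iter m (@sigma (dspoly k n)) (f ^+ m)).
Proof.
move=> /diff_ideal_of_shifted[N0 JN].
have [N [N0N mN]] : exists N, (N0 <= N)%N /\ (m <= N)%N.
  by exists (maxn N0 m); rewrite leq_maxl leq_maxr.
exists N; rewrite -[iter N _ _]/(iter_sigma (dspoly k n) N (f ^+ N)).
rewrite -[in f ^+ _](subnK mN) exprD rmorphM.
apply: is_idealM; first exact: ideal_gen_is_ideal.
rewrite rmorphXn /= -(@rho_tau N 0 N) ?addr0 // -rmorphXn.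
exact: JN.
Qed.

End Descent.
End Inversive.

(** * Solutions and ideal membership *)

Lemma dsmorphism_diff_ideal (S T : dsRingType) (phi : {dsmorphism S -> T})
    (F : set S) x :
  (forall g, F g -> phi g = 0) -> diff_ideal (sigma_orbit F) x -> phi x = 0.
Proof.
move=> phiF; apply: (@ideal_gen_sub _ _ [set y | phi y = 0]).
  split; first exact: rmorph0.
  move=> a y z /= y0 z0; rewrite [LHS]rmorphD [X in X + _]rmorphM.
  by rewrite [X in _ * X]y0 [X in _ + X]z0 mulr0 addr0.
move=> _ [i [_ [j [g Fg ->]] ->]] /=.
have -> : phi (iter i (@delta S) (iter j (@sigma S) g)) =
    iter i (@delta T) (iter j (@sigma T) (phi g)).
  elim: i => [|i IHi] /=; last by rewrite dsmorph_delta IHi.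
  by elim: j => //= j IHj; rewrite dsmorph_sigma IHj.
rewrite phiF // (_ : iter j _ 0 = 0); last first.
  by elim: j => //= j ->; rewrite rmorph0.
by elim: i => //= i ->; rewrite raddf0.
Qed.

Lemma zseq_reduced (K : fieldType) (x : zseq K) m : x ^+ m = 0 -> x = 0.
Proof.
move=> xm; apply/funext => r.
have xmr p : (x ^+ p) r = x r ^+ p.
  by elim: p => [|p IHp]; rewrite ?expr0 // !exprS -IHp.
have /eqP : x r ^+ m = 0 by rewrite -xmr xm.
by rewrite expf_eq0 => /andP[_ /eqP].
Qed.

Lemma vanishes_of_diff_ideal (k : dsiFieldType) n (F : set (dspoly k n))
    (f : dspoly k n) m :
  diff_ideal (sigma_orbit F) (iter m (@sigma (dspoly k n)) (f ^+ m)) ->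
  forall (K : dsFieldType) (iota : {dsmorphism k -> K}) (a : 'I_n -> zseq K),
    is_solution iota a F -> vanishes_at iota a f.
Proof.
move=> Jf K iota a aF; pose phi : {dsmorphism dspoly k n -> zseq K} :=
  dspoly_eval iota a.
apply: (@zseq_reduced _ _ m); rewrite -[dspoly_eval _ _ _]/(phi f) -rmorphXn.
have := dsmorphism_diff_ideal (phi := phi) aF Jf.
move: (f ^+ m) => g {Jf}; elim: m => //= m IHm; rewrite dsmorph_sigma => sg0.
by apply: IHm; apply: (@sigma_inj (zseq K)); rewrite sg0 rmorph0.
Qed.

Lemma exists_shifted_point (k : dsiFieldType) n (F : set (dspoly k n)) f :
  (forall m, ~ diff_ideal (sigma_orbit F) (iter m (@sigma _) (f ^+ m))) ->
  exists (E : fieldType) (p : {rmorphism zpoly k n -> E}),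
    (forall r e g, F g -> p (tau k n r (iter e (@delta _) g)) = 0) /\
    p (tau k n 0 f) != 0.
Proof.
move=> nJ.
have [m /descent[m' /nJ//]|E [p [pF pf]]] :=
  @exists_field_point _ (shifts F) (tau k n 0 f).
by exists E, p; split=> // r e g Fg; apply: pF; exists r, e, g.
Qed.

(** Coefficients may be taken in any extension L of E to which sigma on k
extends: L = E serves when sigma is the identity on k. *)
Lemma exists_nonvanishing_solution (k : dsiFieldType) n
    (char0 : [pchar k] =i pred0) (F : set (dspoly k n)) (f : dspoly k n)
    (E L : fieldType) (p : {rmorphism zpoly k n -> E}) (j : {rmorphism E -> L})
    (s : {rmorphism L -> L}) :
  (forall c, s (j (p (zpolyC k n c))) = j (p (zpolyC k n (sigma c)))) ->
  (forall r e g, F g -> p (tau k n r (iter e (@delta _) g)) = 0) ->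
  p (tau k n 0 f) != 0 ->
  exists (K : dsFieldType) (iota : {dsmorphism k -> K}) (a : 'I_n -> zseq K),
    [/\ is_solution iota a F, ~ vanishes_at iota a f &
        (forall x, s x = x) -> forall x : K, sigma x = x].
Proof.
move=> sj pF pf.
pose q : {rmorphism k -> L} :=
  GRing.RMorphism.clone _ _ (j \o (p \o zpolyC k n)) _.
pose ev r : {rmorphism dspoly k n -> L} :=
  GRing.RMorphism.clone _ _ (j \o (p \o tau k n r)) _.
have [||K [iota [a [aP Kid]]]] :=
  exists_sequence_point char0 (q := q) (ev := ev) sj.
- by move=> r c; rewrite /ev /q /= tauC.
- by move=> r g; exact: (congr1 (fun h => j (p h)) (tau_sigma r g)).
exists K, iota, a; split=> // [g Fg|/aP/(_ 0 0%N)/eqP].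
  by apply/aP => r e; rewrite /ev /= pF // rmorph0.
by rewrite /ev /= fmorph_eq0 (negPf pf).
Qed.

Theorem proposition5p3 (n : nat) (k : dsiFieldType)
    (char0 : [pchar k] =i pred0) (F : set (dspoly k n)) (f : dspoly k n) :
  ((forall (K : dsFieldType) (iota : {dsmorphism k -> K})
           (a : 'I_n -> zseq K),
      is_solution iota a F -> vanishes_at iota a f)
   <->
   (exists m : nat,
      diff_ideal (sigma_orbit F) (iter m (@sigma (dspoly k n)) (f ^+ m))))
  /\
  ((forall c : k, sigma c = c) ->
   ((exists m : nat,
       diff_ideal (sigma_orbit F) (iter m (@sigma (dspoly k n)) (f ^+ m)))
    <->
    (forall (K : dsFieldType) (iota : {dsmorphism k -> K}),
       (forall x : K, sigma x = x) ->
       forall a : 'I_n -> zseq K,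
         is_solution iota a F -> vanishes_at iota a f))).
Proof.
split.
  split=> [solF|[m Jf] K iota a]; last exact: vanishes_of_diff_ideal Jf _ _ _.
  apply: contrapT => /forallNP/exists_shifted_point[E [p [pF pf]]].
  have [L [s [j sj]]] := exists_sigma_extension (@sigma k)
    (GRing.RMorphism.clone _ _ (p \o zpolyC k n) _).
  have [K [iota [a [aF naf _]]]] := exists_nonvanishing_solution char0 sj pF pf.
  exact/naf/solF.
move=> sid; split=> [[m Jf] K iota _ a|solF].
  exact: vanishes_of_diff_ideal Jf _ _ _.
apply: contrapT => /forallNP/exists_shifted_point[E [p [pF pf]]].
have [|K [iota [a [aF naf Kid]]]] := @exists_nonvanishing_solution k n char0 F f
  E E p idfun idfun _ pF pf; first by move=> c; rewrite /= sid.
by apply: naf; apply: solF => //; exact: Kid.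
Qed.
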